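(* Let $E$ be a row-finite directed graph (every vertex emits only finitely many edges), $K$ a field, $L=L_K(E)$, and $n$ a positive integer. The following are equivalent: (i) $L$ has index of nilpotence at most $n$ (i.e. $x^n=0$ for every nilpotent $x\in L$); (ii) there is a graded isomorphism $L\cong_{gr}\bigoplus_{i\in I}M_{n_i}(K)\oplus\bigoplus_{j\in J}M_{n_j}(K[x,x^{-1}])$, where $I,J$ are arbitrary index sets, the matrix rings carry suitable matrix gradings, and $n_i\le n$, $n_j\le n$ for all $i\in I$, $j\in J$. In particular, in this case $L$ is graded semisimple, i.e. a direct sum of graded simple left (resp. right) ideals.
   Context: $L_K(E)$ is the Leavitt path algebra of a directed graph $E=(E^0,E^1,r,s)$ over a field $K$: the $K$-algebra generated by pairwise orthogonal idempotents $v\in E^0$ and elements $e,e^*$ ($e\in E^1$) with relations $s(e)e=e=er(e)$, $r(e)e^*=e^*=e^*s(e)$, $e^*e=r(e)$, $e^*f=0$ for $e\neq f$, and $v=\sum_{s(e)=v}ee^*$ for each vertex emitting a nonempty finite set of edges. It is $\mathbb Z$-graded by $\deg v=0,\deg e=1,\deg e^*=-1$. A matrix grading on $M_t(A)$ for a $\mathbb Z$-graded ring $A$ is given by integers $d_1,\dots,d_t$ with $a\,e_{ij}$ of degree $\deg a+d_i-d_j$ for homogeneous $a$; $K$ is trivially graded and $K[x,x^{-1}]$ is graded with $x$ homogeneous of some positive degree. $\cong_{gr}$ denotes graded isomorphism. *)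

(* Defs.v *)
From HB Require Import structures.
From mathcomp Require Import all_boot all_order all_algebra.
From Stdlib Require List.
Set Implicit Arguments. Unset Strict Implicit. Unset Printing Implicit Defensive.
Import GRing.Theory Num.Theory.
Local Open Scope ring_scope.

(* Associative, not necessarily unital, K-algebras
   (L_K(E) is non-unital when E has infinitely many vertices). *)
Record nalg (K : fieldType) := NAlg {
  nacar :> lmodType K;
  namul : nacar -> nacar -> nacar;
  namulA : forall x y z, namul x (namul y z) = namul (namul x y) z;
  namulDl : forall x y z, namul (x + y) z = namul x z + namul y z;
  namulDr : forall x y z, namul x (y + z) = namul x y + namul x z;
  namulZl : forall (a : K) x y, namul (a *: x) y = a *: namul x y;
  namulZr : forall (a : K) x y, namul x (a *: y) = a *: namul x y }.

Section NAlgDefs.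
Variable K : fieldType.

Definition nalg_hom (A B : nalg K) (h : A -> B) : Prop :=
  (forall x y, h (x + y) = h x + h y) /\
  (forall (a : K) x, h (a *: x) = a *: h x) /\
  (forall x y, h (namul x y) = namul (h x) (h y)).

(* x^m for m >= 1 (napow x 0 := 0 is a dummy value, never used with m = 0) *)
Definition napow (A : nalg K) (x : A) (m : nat) : A :=
  match m with 0%N => 0 | m'.+1 => iter m' (fun y => namul y x) x end.

Definition nil_index_le (A : nalg K) (n : nat) : Prop :=
  forall x : A, (exists m, napow x m.+1 = 0) -> napow x n = 0.

Definition side_mul (A : nalg K) (lft : bool) (x u : A) : A :=
  if lft then namul x u else namul u x.

Definition is_ideal (A : nalg K) (lft : bool) (U : A -> Prop) : Prop :=
  U 0 /\ (forall u v, U u -> U v -> U (u + v)) /\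
  (forall (a : K) u, U u -> U (a *: u)) /\
  (forall x u, U u -> U (side_mul lft x u)).

Definition is_gr_ideal (A : nalg K) (gr : int -> A -> Prop) (lft : bool)
  (U : A -> Prop) : Prop :=
  is_ideal lft U /\
  forall u, U u -> exists k (c : 'I_k -> A) (dg : 'I_k -> int),
    (forall i, gr (dg i) (c i) /\ U (c i)) /\ u = \sum_(i < k) c i.

Definition is_gr_simple_ideal (A : nalg K) (gr : int -> A -> Prop) (lft : bool)
  (U : A -> Prop) : Prop :=
  is_gr_ideal gr lft U /\ (exists u, U u /\ u <> 0) /\
  forall U' : A -> Prop, is_gr_ideal gr lft U' -> (forall u, U' u -> U u) ->
    (forall u, U' u -> u = 0) \/ (forall u, U u -> U' u).

Definition gr_semisimple (A : nalg K) (gr : int -> A -> Prop) (lft : bool) : Prop :=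
  exists (T : Type) (U : T -> A -> Prop),
    (forall t, is_gr_simple_ideal gr lft (U t)) /\
    (forall x : A, exists k (idx : 'I_k -> T) (u : 'I_k -> A),
        (forall i, U (idx i) (u i)) /\ x = \sum_(i < k) u i) /\
    (forall k (idx : 'I_k -> T) (u : 'I_k -> A), injective idx ->
        (forall i, U (idx i) (u i)) -> \sum_(i < k) u i = 0 ->
        forall i, u i = 0).

(* ---------- The graded algebra
   (+)_{i in I} M_{ni i}(K)  (+)  (+)_{j in J} M_{nj j}(K[x,x^-1]).
   An element of K[x,x^-1] is represented by its coefficient function
   int -> K (finitely supported); an element of the direct sum is a
   pair of families of matrices with finite support. *)
Definition dsum (I J : Type) (ni : I -> nat) (nj : J -> nat) : Type :=
  ((forall i, 'M[K]_(ni i)) * (forall j, 'M[int -> K]_(nj j)))%type.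

Section Dsum.
Variables (I J : Type) (ni : I -> nat) (nj : J -> nat).

Definition ds_fin (d : dsum ni nj) : Prop :=
  (exists li : seq I, forall i, ~ List.In i li -> d.1 i = 0) /\
  (exists lj : seq J, forall j, ~ List.In j lj -> forall p q k, d.2 j p q k = 0) /\
  (forall j p q, exists N : nat, forall k, (N < absz k)%N -> d.2 j p q k = 0).

Definition ds_eq (d1 d2 : dsum ni nj) : Prop :=
  (forall i, d1.1 i = d2.1 i) /\ (forall j p q k, d1.2 j p q k = d2.2 j p q k).

(* product of Laurent polynomials u v, valid when u is supported in [-N, N] *)
Definition lmulN (N : nat) (u v : int -> K) (k : int) : K :=
  \sum_(i < (2 * N).+1) u (i%:Z - N%:Z) * v (k - (i%:Z - N%:Z)).

Definition ds_add_rel (d1 d2 d3 : dsum ni nj) : Prop :=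
  (forall i, d3.1 i = d1.1 i + d2.1 i) /\
  (forall j p q k, d3.2 j p q k = d1.2 j p q k + d2.2 j p q k).

Definition ds_scale_rel (a : K) (d1 d3 : dsum ni nj) : Prop :=
  (forall i, d3.1 i = a *: d1.1 i) /\
  (forall j p q k, d3.2 j p q k = a * d1.2 j p q k).

Definition ds_mul_rel (d1 d2 d3 : dsum ni nj) : Prop :=
  (forall i, d3.1 i = d1.1 i *m d2.1 i) /\
  (forall j p q k (N : nat),
     (forall r a, (N < absz a)%N -> d1.2 j p r a = 0) ->
     d3.2 j p q k = \sum_(r < nj j) lmulN N (d1.2 j p r) (d2.2 j r q) k).

(* Matrix gradings: entry (p,q) of M_{ni i}(K) has degree di p - di q;
   x^k e_{pq} in M_{nj j}(K[x,x^-1]) has degree k * tj j + dj p - dj q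
   (x homogeneous of degree tj j > 0). *)
Definition ds_hom (di : forall i, 'I_(ni i) -> int) (tj : J -> nat)
  (dj : forall j, 'I_(nj j) -> int) (m : int) (d : dsum ni nj) : Prop :=
  (forall i p q, d.1 i p q <> 0 -> di i p - di i q = m) /\
  (forall j p q k, d.2 j p q k <> 0 -> k * (tj j)%:Z + dj j p - dj j q = m).

Definition ds_iso (A : nalg K) (phi : A -> dsum ni nj) : Prop :=
  (forall x y, ds_add_rel (phi x) (phi y) (phi (x + y))) /\
  (forall (a : K) x, ds_scale_rel a (phi x) (phi (a *: x))) /\
  (forall x y, ds_mul_rel (phi x) (phi y) (phi (namul x y))) /\
  (forall x, ds_fin (phi x)) /\
  (forall x y, ds_eq (phi x) (phi y) -> x = y) /\
  (forall d, ds_fin d -> exists x, ds_eq (phi x) d).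
End Dsum.

Definition gr_decomp_le (A : nalg K) (gr : int -> A -> Prop) (n : nat) : Prop :=
  exists (I J : Type) (ni : I -> nat) (nj : J -> nat)
         (di : forall i, 'I_(ni i) -> int) (tj : J -> nat)
         (dj : forall j, 'I_(nj j) -> int) (phi : A -> dsum ni nj),
    (forall i, ni i <= n)%N /\ (forall j, nj j <= n)%N /\
    (forall j, 0 < tj j)%N /\ ds_iso phi /\
    (forall m x, gr m x <-> ds_hom di tj dj m (phi x)).

End NAlgDefs.

Section LPA.
Variables (K : fieldType) (V Ed : Type) (s r : Ed -> V).

Definition row_finite : Prop :=
  forall v, exists l : seq Ed, forall e, s e = v -> List.In e l.

(* Leavitt E-family (P v = v, S e = e, Ss e = e^* ) in an algebra B *)
Definition LP_family (B : nalg K) (P : V -> B) (S Ss : Ed -> B) : Prop :=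
  (forall v, namul (P v) (P v) = P v) /\
  (forall v w, v <> w -> namul (P v) (P w) = 0) /\
  (forall e, namul (P (s e)) (S e) = S e /\ namul (S e) (P (r e)) = S e) /\
  (forall e, namul (P (r e)) (Ss e) = Ss e /\ namul (Ss e) (P (s e)) = Ss e) /\
  (forall e, namul (Ss e) (S e) = P (r e)) /\
  (forall e f, e <> f -> namul (Ss e) (S f) = 0) /\
  (forall v (l : seq Ed), List.NoDup l -> (forall e, s e = v <-> List.In e l) ->
     l <> [::] -> P v = \sum_(e <- l) namul (S e) (Ss e)).

(* (L, P, S, Ss) is L_K(E): the universal algebra generated by a Leavitt
   E-family, i.e. the algebra presented by these generators and relations *)
Definition is_LPA (L : nalg K) (P : V -> L) (S Ss : Ed -> L) : Prop :=
  LP_family P S Ss /\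
  forall (B : nalg K) (PB : V -> B) (SB SsB : Ed -> B), LP_family PB SB SsB ->
    (exists h : L -> B, nalg_hom h /\ (forall v, h (P v) = PB v) /\
        (forall e, h (S e) = SB e /\ h (Ss e) = SsB e)) /\
    (forall h1 h2 : L -> B, nalg_hom h1 -> nalg_hom h2 ->
        (forall v, h1 (P v) = PB v) -> (forall e, h1 (S e) = SB e /\ h1 (Ss e) = SsB e) ->
        (forall v, h2 (P v) = PB v) -> (forall e, h2 (S e) = SB e /\ h2 (Ss e) = SsB e) ->
        forall x, h1 x = h2 x).

Inductive LPgen := GVert of V | GEdge of Ed | GGhost of Ed.

Definition gen_deg (g : LPgen) : int :=
  match g with GVert _ => 0 | GEdge _ => 1 | GGhost _ => -1 end.

Section Grade.
Variables (L : nalg K) (P : V -> L) (S Ss : Ed -> L).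

Definition gen_val (g : LPgen) : L :=
  match g with GVert v => P v | GEdge e => S e | GGhost e => Ss e end.

Definition word_val (g : LPgen) (ws : seq LPgen) : L :=
  foldl (fun acc h => namul acc (gen_val h)) (gen_val g) ws.
Definition word_deg (g : LPgen) (ws : seq LPgen) : int :=
  gen_deg g + \sum_(h <- ws) gen_deg h.

Definition LP_grade (m : int) (x : L) : Prop :=
  exists k (c : 'I_k -> K) (w0 : 'I_k -> LPgen) (ws : 'I_k -> seq LPgen),
    (forall i, word_deg (w0 i) (ws i) = m) /\
    x = \sum_(i < k) c i *: word_val (w0 i) (ws i).
End Grade.
End LPA.

(* Main.v *)
Require Import Defs.
From HB Require Import structures.
From mathcomp Require Import all_boot all_order all_algebra.
From mathcomp Require Import boolp functions zify.
Set Implicit Arguments. Unset Strict Implicit. Unset Printing Implicit Defensive.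
Import GRing.Theory Num.Theory.

(** The representation of [L] on functions on the maximal paths of [E], graded
    by an extra integer coordinate, shows that vertices are nonzero and that
    the powers of a cycle are linearly independent.  If [k] paths ending at
    [w] are pairwise incomparable for the prefix order, the elements [p q^*]
    are matrix units of size [k], so an index of nilpotence at most [n] forces
    [k <= n].  Hence no cycle has an exit and no path visits more than [n]
    vertices, so every path ends in a sink or runs into a cycle.  Call a vertex
    terminal if it is a sink or the chosen base point of a cycle [c].  Each
    terminal [w] has at most [n] paths [p] reaching it for the first time, every
    vertex is a finite sum of projections [p p^*] over such paths, and the corner
    [w L w] is [K] or [K[c, c^-1]].  The map sending [a] to the family of
    matrices with entries [p^* a q] is then the graded isomorphism, and since
    homogeneous elements of the corners are invertible, the ideals [L p p^*]
    and [p p^* L] are graded simple.  Conversely a nilpotent matrix of size at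
    most [n] over a field satisfies [A ^ n = 0]. *)

Local Open Scope ring_scope.

(** [L] is known only through its universal property, so no normal form is at hand. Statements about
    all elements come from induction on generators and from the spanning set of the p q^*; every
    lower bound (a vertex is nonzero, coefficients are well defined, degrees are independent) is
    read off from the one representation.

    Paths reaching a base point have to stop at the first visit: p and p c are comparable, so going
    round the cycle would destroy both orthogonality and finiteness. One base point per cycle
    prevents the same block from being counted once for each vertex of the cycle.

    Sinks and cycles share most of the argument: a sink gets the empty cycle of period 0, and
    divisibility by 0 leaves only degree 0, so K is the degenerate case of K[c, c^-1]. The algebra
    need not be unital; finite sums of the p p^* serve as local units. *)

Local Notation "x ** y" := (namul x y) (at level 40, left associativity).

(** * Non-unital algebras, subalgebras and endomorphism algebras *)

Section NalgTheory.
Variables (K : fieldType) (A : nalg K).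
Implicit Types x y z : A.

Lemma namul0l x : 0 ** x = 0 :> A.
Proof. by rewrite -[in LHS](scale0r x) namulZl scale0r. Qed.

Lemma namul0r x : x ** 0 = 0 :> A.
Proof. by rewrite -[in LHS](scale0r x) namulZr scale0r. Qed.

Lemma namul_suml (I : Type) (l : seq I) (Q : pred I) (F : I -> A) x :
  (\sum_(i <- l | Q i) F i) ** x = \sum_(i <- l | Q i) F i ** x.
Proof.
by apply: (big_morph (fun y => y ** x)) => [y z|]; rewrite ?namulDl ?namul0l.
Qed.

Lemma namul_sumr (I : Type) (l : seq I) (Q : pred I) (F : I -> A) x :
  x ** (\sum_(i <- l | Q i) F i) = \sum_(i <- l | Q i) x ** F i.
Proof. by apply: (big_morph (namul x)) => [y z|]; rewrite ?namulDr ?namul0r. Qed.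

Lemma napowS x m : napow x m.+2 = napow x m.+1 ** x.
Proof. by []. Qed.

Definition op_nalg : nalg K :=
  @NAlg K A (fun x y => y ** x)
    (fun x y z => esym (namulA z y x)) (fun x y z => namulDr z x y)
    (fun x y z => namulDl y z x) (fun a x y => namulZr a y x)
    (fun a x y => namulZl a y x).
End NalgTheory.

Section HomTheory.
Variables (K : fieldType) (A B : nalg K) (h : A -> B).
Hypothesis hP : nalg_hom h.

Lemma nalg_hom0 : h 0 = 0.
Proof. by case: hP => _ [hZ _]; rewrite -(scale0r 0) hZ scale0r. Qed.

End HomTheory.

Section SubLmodule.
Variables (K : fieldType) (M : lmodType K) (U : {pred M}).

(** The closure proof is a parameter, so that each such proof gives its own instance of a submodule
    predicate. *)
Definition closed_pred (clU : submod_closed U) : {pred M} := U.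
HB.instance Definition _ (clU : submod_closed U) :=
  GRing.isSubmodClosed.Build K M (closed_pred clU) clU.

Record sublmod (clU : submod_closed U) :=
  Sublmod { sublmod_val : M; _ : sublmod_val \in closed_pred clU }.

HB.instance Definition _ (clU : submod_closed U) :=
  [isSub for @sublmod_val clU].
HB.instance Definition _ (clU : submod_closed U) :=
  [Choice of sublmod clU by <:].
HB.instance Definition _ (clU : submod_closed U) :=
  [SubChoice_isSubLmodule of sublmod clU by <:].
End SubLmodule.

Section SubNalg.
Variables (K : fieldType) (A : nalg K) (U : {pred A}).
Hypotheses (clU : submod_closed U).
Hypothesis mulU : forall x y, x \in U -> y \in U -> x ** y \in U.

Definition sub_mul (x y : sublmod clU) : sublmod clU :=
  Sublmod (mulU (valP x) (valP y)).

Definition sub_nalg : nalg K.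
Proof.
apply: (@NAlg K (sublmod clU) sub_mul) => *; apply: val_inj => /=.
- exact: namulA.
- exact: namulDl.
- exact: namulDr.
- exact: namulZl.
- exact: namulZr.
Defined.
End SubNalg.

Section Endo.
Variables (K : fieldType) (M : lmodType K).

Definition lin_pred : {pred M -> M} := fun f => `[< linear f >].

Fact lin_pred_closed : submod_closed lin_pred.
Proof.
split; first by apply/asboolP => a x y; rewrite /= scaler0 addr0.
move=> a f g /asboolP fl /asboolP gl; apply/asboolP => b x y /=.
rewrite (_ : forall z, (a *: f + g) z = a *: f z + g z) //.
rewrite !(_ : forall z, (a *: f + g) z = a *: f z + g z) //.
by rewrite fl gl !scalerDr !scalerA mulrC addrACA.
Qed.

Definition endo := sublmod lin_pred_closed.

Definition endo_eval (f : endo) : M -> M := val f.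

Lemma endo_evalD (f : endo) x y : endo_eval f (x + y) = endo_eval f x + endo_eval f y.
Proof. by have := asboolP _ (valP f) 1 x y; rewrite !scale1r. Qed.

Lemma endo_eval0 (f : endo) : endo_eval f 0 = 0.
Proof. by apply: (addrI (endo_eval f 0)); rewrite -endo_evalD !addr0. Qed.

Lemma endo_evalZ (f : endo) a x : endo_eval f (a *: x) = a *: endo_eval f x.
Proof.
by have := asboolP _ (valP f) a x 0; rewrite /= -!/(endo_eval _ _) endo_eval0 !addr0.
Qed.

Lemma endo_scaleE a (f : endo) x : endo_eval (a *: f) x = a *: endo_eval f x.
Proof. by []. Qed.

Lemma endo_ext (f g : endo) : endo_eval f =1 endo_eval g -> f = g.
Proof. by move=> fg; apply/val_inj/funext. Qed.

Fact endo_comp_subproof (f g : endo) :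
  (endo_eval f \o endo_eval g) \in closed_pred lin_pred_closed.
Proof. by apply/asboolP => a x y /=; rewrite !endo_evalD !endo_evalZ. Qed.

Definition endo_comp (f g : endo) : endo := Sublmod (endo_comp_subproof f g).

Definition endo_nalg : nalg K.
Proof.
apply: (@NAlg K endo endo_comp) => [f g h|f g h|f g h|a f g|a f g];
  apply: endo_ext => x //=.
- exact: endo_evalD.
- exact: endo_evalZ.
Defined.
End Endo.

(** * The representation on maximal paths *)

Lemma InP (T : eqType) (l : seq T) x : List.In x l <-> x \in l.
Proof.
elim: l => //= y l IH; rewrite inE; split.
  by case=> [->|/IH ->]; rewrite ?eqxx ?orbT.
by case/orP => [/eqP ->|/IH]; [left|right].
Qed.

Lemma NoDupP (T : eqType) (l : seq T) : uniq l -> List.NoDup l.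
Proof.
elim: l => [_|x l IH /= /andP[xl ul]]; first exact: List.NoDup_nil.
by apply: List.NoDup_cons; [move/InP; apply/negP|apply: IH].
Qed.

(** * Generation by vertices, edges and ghost edges *)

Section Generation.
Variables (K : fieldType) (V Ed : Type) (s r : Ed -> V).
Variables (L : nalg K) (P : V -> L) (S Ss : Ed -> L).
Hypothesis HL : is_LPA s r P S Ss.

(** The elements satisfying [U] form a subalgebra containing the generators. The universal map into
    it, followed by the inclusion, agrees with the identity by uniqueness. *)
Lemma LPA_ind (U : L -> Prop) :
  U 0 -> (forall x y, U x -> U y -> U (x + y)) ->
  (forall (a : K) x, U x -> U (a *: x)) ->
  (forall x y, U x -> U y -> U (x ** y)) ->
  (forall v, U (P v)) -> (forall e, U (S e)) -> (forall e, U (Ss e)) ->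
  forall x, U x.
Proof.
move=> U0 UD UZ UM UP US USs x.
pose Up : {pred L} := fun x => `[< U x >].
have clU : submod_closed Up.
  split; first exact/asboolP.
  by move=> a y z /asboolP Uy /asboolP Uz; apply/asboolP/UD => //; apply: UZ.
have mulU y z : y \in Up -> z \in Up -> y ** z \in Up.
  by move=> /asboolP Uy /asboolP Uz; apply/asboolP/UM.
pose B := sub_nalg clU mulU.
have inU y (Uy : U y) : y \in closed_pred clU by apply/asboolP.
pose PB v : B := Sublmod (inU _ (UP v)).
pose SB e : B := Sublmod (inU _ (US e)).
pose SsB e : B := Sublmod (inU _ (USs e)).
have [famL univ] := HL.
have famB : LP_family s r PB SB SsB.
  case: famL => PP [PQ [PS [PSs [SsS [SsT CK]]]]].
  split; [|split; [|split; [|split; [|split; [|split]]]]].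
  - by move=> v; apply/val_inj/PP.
  - by move=> v w vw; apply/val_inj/PQ.
  - by move=> e; split; apply/val_inj => /=; apply PS.
  - by move=> e; split; apply/val_inj => /=; apply PSs.
  - by move=> e; apply/val_inj/SsS.
  - by move=> e f ef; apply/val_inj/SsT.
  - move=> v l nl lP ln; apply: val_inj; rewrite /= (CK v l nl lP ln).
    by elim/big_rec2: _ => // e y1 y2 _ ->.
have [[h [[hD [hZ hM]] [hP hS]]] _] := univ B PB SB SsB famB.
have [_ uniqL] := univ L P S Ss famL.
have -> : x = val (h x).
  apply: (uniqL id (fun y => val (h y))) => //.
  - split; [|split] => [y z|a y|y z]; rewrite ?hD ?hZ ?hM //.
  - by move=> v; rewrite hP.
  - by move=> e; have [-> ->] := hS e.
exact: asboolP _ (valP (h x)).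
Qed.
End Generation.

(** * Weighted composition operators *)

Section WeightedComposition.
Variables (K : fieldType) (Z : Type).
Notation M := (Z -> K^o).

Fact wcomp_subproof (c : pred Z) (g : Z -> Z) :
  (fun (f : M) z => if c z then f (g z) else 0) \in closed_pred (@lin_pred_closed K M).
Proof.
apply/asboolP => a f1 f2; apply/funext => z.
rewrite (_ : forall z, (a *: f1 + f2) z = a *: f1 z + f2 z) //.
rewrite [RHS](_ : _ = a *: (if c z then f1 (g z) else 0) + (if c z then f2 (g z) else 0)) //.
by case: (c z); rewrite ?scaler0 ?addr0.
Qed.

Definition wcomp (c : pred Z) (g : Z -> Z) : endo_nalg M := Sublmod (wcomp_subproof c g).

Lemma wcompE c g f z : endo_eval (wcomp c g) f z = if c z then f (g z) else 0.
Proof. by []. Qed.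

Lemma wcomp_mulE (u v : endo_nalg M) f : endo_eval (u ** v) f = endo_eval u (endo_eval v f).
Proof. by []. Qed.

(** On points the left factor moves first. As products keep this form, the defining relations other
    than the sum relation reduce to comparing supports and maps. *)
Lemma wcompM (c : pred Z) (g : Z -> Z) (c' : pred Z) (g' : Z -> Z) :
  wcomp c g ** wcomp c' g' = wcomp (fun z => c z && c' (g z)) (g' \o g).
Proof.
apply: endo_ext => f; apply/funext => z; rewrite wcomp_mulE !wcompE.
by case: (c z).
Qed.

Lemma eq_wcomp (c : pred Z) (g : Z -> Z) (c' : pred Z) (g' : Z -> Z) : c =1 c' -> (forall z, c z -> g z = g' z) ->
  wcomp c g = wcomp c' g'.
Proof.
move=> cc gg; apply: endo_ext => f; apply/funext => z; rewrite !wcompE -cc.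
by case: ifP => // /gg ->.
Qed.

Lemma wcomp0 (c : pred Z) (g : Z -> Z) : c =1 xpred0 -> wcomp c g = 0.
Proof. by move=> c0; apply: endo_ext => f; apply/funext => z; rewrite wcompE c0. Qed.

Lemma wcomp_scaleE a (u : endo_nalg M) f z :
  endo_eval (a *: u) f z = a * endo_eval u f z.
Proof. by rewrite endo_scaleE. Qed.

Lemma wcomp_sumE (I : Type) (l : seq I) (F : I -> endo_nalg M) f z :
  endo_eval (\sum_(i <- l) F i) f z = \sum_(i <- l) endo_eval (F i) f z.
Proof. by elim/big_rec2: _ => // i y1 y2 _ <-. Qed.
End WeightedComposition.

(* [L] acts on functions on the space of pairs (maximal path, level): an edge
   is prepended to the path and raises the level by one.  A maximal path is a
   sequence of pairs (vertex, outgoing edge), constant with edge [None] once a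
   sink is reached.  The level makes degrees visible, so that this
   representation separates the powers of a cycle. *)
Section MaximalPaths.
Variables (V Ed : eqType) (s r : Ed -> V).
Definition tail_seq := nat -> V * option Ed.
Implicit Types x y : tail_seq.

Definition sink v := forall e, s e <> v.

Definition maximal x := forall i,
  if (x i).2 is Some e then s e = (x i).1 /\ r e = (x i.+1).1
  else sink (x i).1 /\ x i.+1 = x i.

Definition shift x : tail_seq := fun i => x i.+1.
Definition prepend e x : tail_seq := fun i => if i is j.+1 then x j else (s e, Some e).

Lemma maximal_shift x : maximal x -> maximal (shift x).
Proof. by move=> mx i; apply: (mx i.+1). Qed.

Lemma maximal_prepend e x : maximal x -> (x 0%N).1 = r e -> maximal (prepend e x).
Proof. by move=> mx x0 [|i] //=; apply: mx. Qed.

Lemma shiftK x e : x 0%N = (s e, Some e) -> prepend e (shift x) = x.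
Proof. by move=> x0; apply/funext => -[|i]. Qed.

Lemma prependK x e : shift (prepend e x) = x.
Proof. by apply/funext. Qed.

Lemma maximal_exists v : exists x, maximal x /\ (x 0%N).1 = v.
Proof.
have /choice[f fP] : forall u, exists o : option Ed,
    if o is Some e then s e = u else sink u.
  move=> u; have [[e eu]|nu] := pselect (exists e, s e = u); first by exists (Some e).
  by exists None => e eu; apply: nu; exists e.
pose nx u := if f u is Some e then r e else u.
exists (fun i => (iter i nx v, f (iter i nx v))); split=> // i /=.
rewrite /nx -/nx; move: (fP (iter i nx v)).
by case E : (f _) => [e|] //= ?; rewrite E.
Qed.

End MaximalPaths.

Section Representation.
Variables (K : fieldType) (V Ed : eqType) (s r : Ed -> V).
Notation X := (tail_seq V Ed).
Notation Z := (X * int)%type.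
Notation M := (Z -> K^o).
Notation maximal := (maximal s r).

Definition repP v : endo_nalg M :=
  wcomp K (fun z => `[< maximal z.1 >] && ((z.1 0%N).1 == v)) id.
Definition repS e : endo_nalg M :=
  wcomp K (fun z => `[< maximal z.1 >] && (z.1 0%N == (s e, Some e)))
        (fun z => (shift z.1, z.2 - 1)).
Definition repSs e : endo_nalg M :=
  wcomp K (fun z => `[< maximal z.1 >] && ((z.1 0%N).1 == r e))
        (fun z => (prepend s e z.1, z.2 + 1)).

(** For a maximal path x starting at [r e], [repS e] sends the indicator of (x, i) to that of (e x,
    i + 1); on functions this reads as removing e and lowering the level. *)
Lemma rep_family : LP_family s r repP repS repSs.
Proof.
split; [|split; [|split; [|split; [|split; [|split]]]]].
- by move=> v; rewrite wcompM; apply: eq_wcomp => // z; rewrite andbb.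
- move=> v w vw; rewrite wcompM; apply: wcomp0 => z /=.
  by apply/negP => /andP[/andP[_ /eqP zv] /andP[_ /eqP zw]]; apply: vw; rewrite -zv.
- move=> e; split; rewrite wcompM; apply: eq_wcomp => //= z.
    by case: asboolP => //= _; case: (z.1 0%N =P _) => [->|]; rewrite ?andbF //= ?eqxx.
  case: asboolP => //= mz; case: eqP => //= z0.
  have := mz 0%N; rewrite z0 /= => -[_ re].
  by rewrite (asboolT (maximal_shift mz)) /shift -re eqxx.
- move=> e; split; rewrite wcompM; apply: eq_wcomp => //= z.
    by rewrite andbb.
  case: asboolP => //= mz; case: eqP => //= z0.
  by rewrite asboolT ?eqxx //; apply: maximal_prepend.
- move=> e; rewrite wcompM; apply: eq_wcomp => [z|z] /=.
    case: asboolP => //= mz; case: eqP => //= z0.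
    by rewrite asboolT ?eqxx //; apply: maximal_prepend.
  by rewrite prependK addrK; case: z.
- move=> e f ef; rewrite wcompM; apply: wcomp0 => z /=.
  by apply/negP => /and3P[_ _ /eqP[_ /ef]].
- move=> v l nl lP ln; apply: endo_ext => g; apply/funext => z.
  rewrite wcompE wcomp_sumE.
  have term e : endo_eval (repS e ** repSs e) g z =
     if `[< maximal z.1 >] && (z.1 0%N == (s e, Some e)) then g z else 0.
    rewrite wcompM wcompE /=.
    case: asboolP => //= mz; case: eqP => //= z0.
    have := mz 0%N; rewrite z0 /= => -[_ re].
    rewrite (asboolT (maximal_shift mz)) /shift -re eqxx /= -/(shift _) shiftK // subrK.
    by case: (z).
  under eq_bigr do rewrite term.
  case: asboolP => mz /=; last by rewrite big1.
  (* An edge [None] means that the path rests at a sink, whereas [v] emits the edges of the nonempty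
     list [l]. In the other case only the term of the first edge of the path can survive. *)
  case z0 : (z.1 0%N) => [u [e|]] /=; last first.
    rewrite big1 => [|e _]; last by case: eqP.
    case: (u =P v) => // uv.
    have := mz 0%N; rewrite z0 /= => -[su _].
    case: l ln lP {nl} => // e l _ lP.
    by case: (su e); rewrite uv; apply/lP; left.
  have := mz 0%N; rewrite z0 /= => -[<- _].
  have eqe f : ((s e, Some e) == (s f, Some f)) = (f == e).
    by apply/eqP/eqP => [[_ ->]|->].
  under eq_bigr do rewrite eqe.
  case: eqP => [/lP|nev]; last first.
    rewrite big_seq big1 // => f; case: eqP => // -> el.
    by case: nev; apply/lP/InP.
  elim: l nl {ln lP term} => //= f l IH nl; inversion nl; subst.
  case=> [<-|el].
    rewrite big_cons eqxx big1_seq ?addr0 // => f' /andP[_ fl]; case: eqP => // fe; case: H1.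
    by rewrite -fe; apply/InP.
  rewrite big_cons -IH //; case: eqP => [fe|]; last by rewrite add0r.
  by case: H1; rewrite fe.
Qed.
End Representation.

(** * Path elements and the grading *)

Section Span.
Variables (K : fieldType) (A : nalg K).

Inductive lspan (G : A -> Prop) : A -> Prop :=
| lspan0 : lspan G 0
| lspan_cons a g x : G g -> lspan G x -> lspan G (a *: g + x).

Implicit Types G H : A -> Prop.

Lemma lspanD G x y : lspan G x -> lspan G y -> lspan G (x + y).
Proof.
elim=> [|a g {}x Gg _ IH] sy; first by rewrite add0r.
by rewrite -addrA; apply: lspan_cons => //; apply: IH.
Qed.

Lemma lspanZ G b x : lspan G x -> lspan G (b *: x).
Proof.
elim=> [|a g {}x Gg _ IH]; first by rewrite scaler0; apply: lspan0.
by rewrite scalerDr scalerA; apply: lspan_cons.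
Qed.

Lemma lspan_gen G g : G g -> lspan G g.
Proof. by move=> Gg; rewrite -[g]addr0 -[g]scale1r; apply/lspan_cons/lspan0. Qed.

Lemma lspan_sum G (I : eqType) (l : seq I) (F : I -> A) :
  (forall i, i \in l -> lspan G (F i)) -> lspan G (\sum_(i <- l) F i).
Proof.
elim: l => [|i l IH] Fl; first by rewrite big_nil; apply: lspan0.
rewrite big_cons; apply: lspanD; first by apply: Fl; rewrite mem_head.
by apply: IH => j jl; apply: Fl; rewrite inE jl orbT.
Qed.

Lemma lspan_mul G1 G2 H x y : (forall g h, G1 g -> G2 h -> lspan H (g ** h)) ->
  lspan G1 x -> lspan G2 y -> lspan H (x ** y).
Proof.
move=> GGH s1 s2; elim: s1 => [|a g {}x Gg _ IH]; first by rewrite namul0l; apply: lspan0.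
rewrite namulDl namulZl; apply: lspanD => //; apply: lspanZ.
elim: s2 => [|b h {IH}y Hh _ IH]; first by rewrite namul0r; apply: lspan0.
by rewrite namulDr namulZr; apply: lspanD => //; apply/lspanZ/GGH.
Qed.

Lemma lspan_linear0 (W : lmodType K) (f : A -> W) G x :
  (forall y z, f (y + z) = f y + f z) -> (forall a y, f (a *: y) = a *: f y) ->
  (forall g, G g -> f g = 0) -> lspan G x -> f x = 0.
Proof.
move=> fD fZ fG; elim=> [|a g {}x Gg _ IH]; first by rewrite -(scale0r 0) fZ scale0r.
by rewrite fD fZ fG // IH scaler0 addr0.
Qed.
End Span.

Section GraphPaths.
Variables (V Ed : eqType) (s r : Ed -> V).

(* A path is the list of its edges together with its range [w], so that the
   path of length 0 at [w] is ([::], w). *)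
Definition src (l : seq Ed) w := if l is e :: _ then s e else w.

Fixpoint is_path (l : seq Ed) w :=
  if l is e :: l' then (r e == src l' w) && is_path l' w else true.

Lemma src_cat l m w : src (l ++ m) w = src l (src m w).
Proof. by case: l. Qed.

Lemma is_path_cat l m w : is_path (l ++ m) w = is_path l (src m w) && is_path m w.
Proof. by elim: l => //= e l ->; rewrite src_cat andbA. Qed.

Lemma is_path_end l u v : is_path l u -> is_path l v -> src l u = src l v -> u = v.
Proof.
elim: l => //= e l IH /andP[/eqP re lu] /andP[/eqP re' lv] _.
by apply: IH => //; rewrite -re -re'.
Qed.
End GraphPaths.

Section PathElements.
Variables (K : fieldType) (V Ed : eqType) (s r : Ed -> V).
Variables (L : nalg K) (P : V -> L) (S Ss : Ed -> L).
Hypothesis HL : is_LPA s r P S Ss.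
Notation src := (src s).
Notation is_path := (is_path s r).

Lemma vert_idem v : P v ** P v = P v.
Proof. by case: HL => -[]. Qed.

Lemma vert_orth v w : v <> w -> P v ** P w = 0.
Proof. by case: HL => -[_ [+ _]] _; apply. Qed.

Lemma vert_edge e : P (s e) ** S e = S e.
Proof. by case: HL => -[_ [_ [/(_ e)[]]]]. Qed.

Lemma edge_vert e : S e ** P (r e) = S e.
Proof. by case: HL => -[_ [_ [/(_ e)[]]]]. Qed.

Lemma vert_ghost e : P (r e) ** Ss e = Ss e.
Proof. by case: HL => -[_ [_ [_ [/(_ e)[]]]]]. Qed.

Lemma ghost_vert e : Ss e ** P (s e) = Ss e.
Proof. by case: HL => -[_ [_ [_ [/(_ e)[]]]]]. Qed.

Lemma ghost_edge e : Ss e ** S e = P (r e).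
Proof. by case: HL => -[_ [_ [_ [_ [+ _]]]]] _; apply. Qed.

Lemma ghost_edge0 e f : e <> f -> Ss e ** S f = 0.
Proof. by case: HL => -[_ [_ [_ [_ [_ [+ _]]]]]] _; apply. Qed.

Definition pX l w := foldr (fun e a => S e ** a) (P w) l.
Definition pY l w := foldr (fun e a => a ** Ss e) (P w) l.

Lemma src_pX l w : P (src l w) ** pX l w = pX l w.
Proof. by case: l => [|e l] /=; rewrite ?vert_idem // namulA vert_edge. Qed.

Lemma pY_src l w : pY l w ** P (src l w) = pY l w.
Proof. by case: l => [|e l] /=; rewrite ?vert_idem // -namulA ghost_vert. Qed.

Lemma pX_end l w : pX l w ** P w = pX l w.
Proof. by elim: l => [|e l IH] /=; rewrite ?vert_idem // -namulA IH. Qed.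

Lemma end_pY l w : P w ** pY l w = pY l w.
Proof. by elim: l => [|e l IH] /=; rewrite ?vert_idem // namulA IH. Qed.

Lemma vert_pX0 v l w : v <> src l w -> P v ** pX l w = 0.
Proof. by move=> vl; rewrite -src_pX namulA vert_orth // namul0l. Qed.

Lemma pY_vert0 v l w : v <> src l w -> pY l w ** P v = 0.
Proof. by move=> vl; rewrite -pY_src -namulA vert_orth ?namul0r // => /esym. Qed.

Lemma pX_cat l m w : pX l (src m w) ** pX m w = pX (l ++ m) w.
Proof. by elim: l => [|e l IH] /=; rewrite ?src_pX // -namulA IH. Qed.

Lemma pY_cat l m w : pY m w ** pY l (src m w) = pY (l ++ m) w.
Proof. by elim: l => [|e l IH] /=; rewrite ?pY_src // namulA IH. Qed.

Lemma ghost_edge_mid e l w m z : r e = src m z ->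
  pY (e :: l) w ** pX (e :: m) z = pY l w ** pX m z.
Proof.
move=> rm /=; rewrite -namulA [Ss e ** _]namulA ghost_edge rm.
by rewrite src_pX.
Qed.

Lemma pY_pX_prefix l m z : is_path (l ++ m) z ->
  pY l (src m z) ** pX (l ++ m) z = pX m z.
Proof.
elim: l => [|e l IH]; first by rewrite /= src_pX.
rewrite [_ ++ _]/= => /andP[/eqP re pm].
by rewrite ghost_edge_mid // IH.
Qed.

Lemma pY_prefix_pX l m z : is_path (l ++ m) z ->
  pY (l ++ m) z ** pX l (src m z) = pY m z.
Proof.
elim: l => [|e l IH]; first by rewrite /= pY_src.
rewrite [_ ++ _]/= => /andP[/eqP re pm].
by rewrite ghost_edge_mid ?IH // re src_cat.
Qed.

Lemma pY_pX_same l w : is_path l w -> pY l w ** pX l w = P w.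
Proof. by move=> pl; have /= := @pY_pX_prefix l [::] w; rewrite cats0; apply. Qed.

Lemma pY_pX_src0 l u m z : src l u <> src m z -> pY l u ** pX m z = 0.
Proof. by move=> lm; rewrite -pY_src -namulA vert_pX0 // namul0r. Qed.

(** Common leading edges cancel by e^* e = r(e) until two distinct edges meet. *)
Lemma pY_pX0 l u m z : ~~ prefix l m -> ~~ prefix m l -> pY l u ** pX m z = 0.
Proof.
elim: l m => [|e l IH] [|f m] //= lm ml.
case: (eqVneq e f) lm ml => [<- /= lm ml|ef _ _]; last first.
  by rewrite -namulA [Ss e ** _]namulA ghost_edge0 ?namul0l ?namul0r //; apply/eqP.
case: (src l u =P r e) => rl.
  rewrite -namulA [Ss e ** _]namulA ghost_edge -rl.
  by rewrite namulA pY_src IH.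
by rewrite -namulA [Ss e ** _]namulA ghost_edge namulA pY_vert0 ?namul0l // => /esym.
Qed.

Definition is_pXY x :=
  exists l m w, [/\ is_path l w, is_path m w & x = pX l w ** pY m w].

(** The inner product of a ghost path and a path cancels to the tail of the longer one if the
    sources agree and one is a prefix of the other, and vanishes otherwise. *)
Lemma pXY_mul x y : is_pXY x -> is_pXY y -> lspan is_pXY (x ** y).
Proof.
move=> [a [b [u [pa pb ->]]]] [c [d [z [pc pd ->]]]].
rewrite namulA -[pX a u ** _ ** _]namulA.
have [bc|bc] := boolP (src b u == src c z); last first.
  rewrite pY_pX_src0; last by apply/eqP.
  by rewrite namul0r namul0l; apply: lspan0.
case: (boolP (prefix b c)) => [/prefixP[m cm]|nbc].
  subst c; have um : u = src m z.
    move: pc; rewrite is_path_cat => /andP[pbm pm].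
    by apply: (is_path_end pb pbm); rewrite -src_cat; apply/eqP.
  apply: lspan_gen; exists (a ++ m), d, z; split => //.
    by move: pc; rewrite !is_path_cat -um pa => /andP[_ ->].
  by rewrite um pY_pX_prefix // pX_cat.
case: (boolP (prefix c b)) => [/prefixP[m bm]|ncb].
  subst b; have zm : z = src m u.
    move: pb; rewrite is_path_cat => /andP[pcm pm].
    by apply: (is_path_end pc pcm); rewrite -src_cat; apply/esym/eqP.
  apply: lspan_gen; exists a, (d ++ m), u; split => //.
    by move: pb; rewrite !is_path_cat -zm pd => /andP[_ ->].
  by rewrite zm pY_prefix_pX // -namulA pY_cat.
by rewrite pY_pX0 // namul0r namul0l; apply: lspan0.
Qed.

Lemma lspan_pXY x : lspan is_pXY x.
Proof.
apply: (LPA_ind HL) x.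
- exact: lspan0.
- by move=> x y; apply: lspanD.
- by move=> a x; apply: lspanZ.
- by move=> x y; apply: lspan_mul => g h; apply: pXY_mul.
- by move=> v; apply: lspan_gen; exists [::], [::], v; split=> //=; rewrite vert_idem.
- move=> e; apply: lspan_gen; exists [:: e], [::], (r e).
  by split=> //=; rewrite ?eqxx // -namulA vert_idem edge_vert.
- move=> e; apply: lspan_gen; exists [::], [:: e], (r e).
  by split=> //=; rewrite ?eqxx // namulA vert_idem vert_ghost.
Qed.

Notation gr := (LP_grade P S Ss).

Lemma word_val_cat g ws h vs :
  word_val P S Ss g (ws ++ h :: vs) =
  word_val P S Ss g ws ** word_val P S Ss h vs.
Proof.
elim/last_ind: vs => [|vs k IH]; first by rewrite /word_val foldl_cat.
by rewrite -rcons_cons -rcons_cat /word_val !foldl_rcons -/(word_val _ _ _ _ _) IH namulA.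
Qed.

Lemma word_deg_cat (g : LPgen V Ed) ws h vs :
  word_deg g (ws ++ h :: vs) = word_deg g ws + word_deg h vs.
Proof. by rewrite /word_deg big_cat big_cons /= !addrA. Qed.

Definition is_word m x := exists g ws, word_deg g ws = m /\ x = word_val P S Ss g ws.

(** Passing from indexed sums to an inductive span gives the closure properties by induction on
    linear combinations. *)
Lemma gradeP m x : gr m x <-> lspan (is_word m) x.
Proof.
split=> [[k [c [w0 [ws [wm ->]]]]]|].
  rewrite -[\sum_(i < k) _]big_filter filter_predT; apply: lspan_sum => i _.
  by apply/lspanZ/lspan_gen; exists (w0 i), (ws i).
elim=> [|a _ y [g [vs [gm ->]]] _ [k [c [w0 [ws [wm ->]]]]]].
  have ord0E (i : 'I_0) : LPgen V Ed by case: i.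
  by exists 0%N, (fun=> 0), ord0E, (fun=> [::]); split; [case|rewrite big_ord0].
exists k.+1, (fun i => if unlift ord0 i is Some j then c j else a),
  (fun i => if unlift ord0 i is Some j then w0 j else g),
  (fun i => if unlift ord0 i is Some j then ws j else vs).
split=> [i|]; first by case: unliftP => [j|] _.
rewrite big_ord_recl unlift_none; congr (_ + _).
by apply: eq_bigr => i _; rewrite liftK.
Qed.

Lemma grade0 m : gr m 0.
Proof. exact/gradeP/lspan0. Qed.

Lemma gradeZ m a x : gr m x -> gr m (a *: x).
Proof. by move=> /gradeP sx; apply/gradeP/lspanZ. Qed.

Lemma grade_sum m (I : eqType) (l : seq I) (F : I -> L) :
  (forall i, i \in l -> gr m (F i)) -> gr m (\sum_(i <- l) F i).
Proof. by move=> Fl; apply/gradeP/lspan_sum => i /Fl/gradeP. Qed.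

Lemma gradeM m k x y : gr m x -> gr k y -> gr (m + k) (x ** y).
Proof.
move=> /gradeP sx /gradeP sy; apply/gradeP.
apply: lspan_mul sx sy => _ _ [g [ws [<- ->]]] [h [vs [<- ->]]].
by apply: lspan_gen; exists g, (ws ++ h :: vs); rewrite word_deg_cat word_val_cat.
Qed.

Lemma grade_gen g : gr (gen_deg g) (gen_val P S Ss g).
Proof.
by apply/gradeP/lspan_gen; exists g, [::]; rewrite /word_deg big_nil addr0.
Qed.

Lemma grade_pX l w : gr (size l)%:Z (pX l w).
Proof.
elim: l => [|e l IH]; first exact: (grade_gen (GVert _ w)).
by have := gradeM (grade_gen (GEdge _ e)) IH; rewrite -intS.
Qed.

Lemma grade_pY l w : gr (- (size l)%:Z) (pY l w).
Proof.
elim: l => [|e l IH]; first exact: (grade_gen (GVert _ w)).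
by have := gradeM IH (grade_gen (GGhost _ e)); rewrite /= intS opprD addrC.
Qed.

Definition is_homog x := exists m, gr m x.

Lemma lspan_homog x : lspan is_homog x.
Proof.
apply: (LPA_ind HL) x.
- exact: lspan0.
- by move=> x y; apply: lspanD.
- by move=> a x; apply: lspanZ.
- move=> x y; apply: lspan_mul => g h [m gm] [k hk].
  by apply: lspan_gen; exists (m + k); apply: gradeM.
- by move=> v; apply: lspan_gen; exists 0; apply: (grade_gen (GVert _ v)).
- by move=> e; apply: lspan_gen; exists 1; apply: (grade_gen (GEdge _ e)).
- by move=> e; apply: lspan_gen; exists (-1); apply: (grade_gen (GGhost _ e)).
Qed.
End PathElements.

(** * Nilpotent matrices *)

Section NilpotentMatrices.

(** The recursion mirrors [napow]: [f i] is A^(i+1) for A = [f 0]. The minimal polynomial divides a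
    power of X, hence is some X^d, and d is at most the size by Cayley-Hamilton. *)
Lemma mx_nilpotent_bound (F : fieldType) N (f : nat -> 'M[F]_N) m k :
  (forall i, f i.+1 = f i *m f 0%N) -> f m = 0 -> (N <= k.+1)%N -> f k = 0.
Proof.
case: N f => [|N] f fS fm Nk; first by rewrite [f k]flatmx0.
have fE i : f i = (f 0%N) ^+ i.+1.
  by elim: i => [|i IH]; rewrite ?expr1 // fS IH [in RHS]exprSr.
set A := f 0%N in fE.
have /(mxminpoly_min) : horner_mx A ('X^(m.+1)) = 0.
  by rewrite rmorphXn /= horner_mx_X -fE.
rewrite -['X]subr0 -polyC0 => /dvdp_exp_XsubCP[d _ ].
rewrite polyC0 subr0 => pE.
have /eqP pd : mxminpoly A == 'X^d.
  by rewrite -eqp_monic ?monicXn // mxminpoly_monic.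
have dN : (d <= N.+1)%N.
  rewrite -ltnS -(size_polyXn F d) -pd -(size_char_poly A) dvdp_leq ?mxminpoly_dvd_char //.
  exact/monic_neq0/char_poly_monic.
have Ad : A ^+ d = 0 by have := mx_root_minpoly A; rewrite pd rmorphXn /= horner_mx_X.
by rewrite fE -(subnK (leq_trans dN Nk)) exprD Ad mulr0.
Qed.

Variable K : fieldType.

(** Extension by zero to negative degrees, for comparison with Laurent coefficients. *)
Definition coefz (p : {poly K}) (z : int) : K := if z is Posz i then p`_i else 0.

Lemma coefzD p q z : coefz (p + q) z = coefz p z + coefz q z.
Proof. by case: z => i /=; rewrite ?coefD ?addr0. Qed.

Lemma coefz_sum (I : Type) (l : seq I) (F : I -> {poly K}) z :
  coefz (\sum_(i <- l) F i) z = \sum_(i <- l) coefz (F i) z.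
Proof.
apply: (big_morph (fun p => coefz p z)) => [p q|]; first exact: coefzD.
by case: z => i //=; rewrite coef0.
Qed.

Lemma coefz_mul (p q : {poly K}) z b : (size p <= b)%N ->
  coefz (p * q) z = \sum_(i < b) p`_i * coefz q (z - i%:Z).
Proof.
move=> pb; rewrite -{1}(coefK p) poly_def mulr_suml.
rewrite (big_ord_widen b (fun i => p`_i *: 'X^i * q)) // big_mkcond coefz_sum.
apply: eq_bigr => i _; case: ifP => [_|/negbT]; last first.
  by rewrite -leqNgt => pi; rewrite nth_default // mul0r; case: (z) => j //=; rewrite coef0.
have -> : coefz (p`_i *: 'X^i * q) z = p`_i * coefz ('X^i * q) z.
  by rewrite -scalerAl; case: (z) => j /=; rewrite ?coefZ ?mulr0.
congr (_ * _); case: (z) => j /=; last by rewrite NegzE (_ : - j.+1%:Z - i%:Z = Negz (j + i)) //; lia.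
rewrite coefXnM; case: ltnP => ij.
  by rewrite (_ : j%:Z - i%:Z = Negz (i - j).-1) //; lia.
by rewrite (_ : j%:Z - i%:Z = (j - i)%N) //; lia.
Qed.

(* After multiplication by a power of the variable, a matrix of Laurent
   polynomials becomes a matrix over the fraction field of K[x]. *)
Lemma laurent_nilpotent_bound N (f : nat -> 'M[int -> K]_N) (B m k : nat) :
  (forall p q a, (B < absz a)%N -> f 0%N p q a = 0) ->
  (forall i p q e (b : nat), (forall t a, (b < absz a)%N -> f i p t a = 0) ->
     f i.+1 p q e = \sum_(t < N) lmulN b (f i p t) (f 0%N t q) e) ->
  (forall p q e, f m p q e = 0) -> (N <= k.+1)%N ->
  forall p q e, f k p q e = 0.
Proof.
move=> fB fS fm Nk.
(* [G] is x^B times [f 0]: a support in [-B, B] is moved into [0, 2B]. *)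
pose G : 'M[{poly K}]_N := \matrix_(p, q) \poly_(i < (2 * B).+1) f 0%N p q (i%:Z - B%:Z).
pose g i := iter i (fun H => H *m G) G.
have GE p q z : coefz (G p q) z = f 0%N p q (z - B%:Z).
  case: z => i; rewrite /= ?mxE ?coef_poly; last by rewrite fB //; lia.
  by case: ltnP => // iB; rewrite fB //; lia.
(* Invariant: [g i] is x^((i+1)B) times [f i]. The size bound shows that [f i] is supported in the
   window over which [lmulN] sums. *)
have gE i : (forall p q, size (g i p q) <= (2 * (i.+1 * B)).+1)%N /\
    forall p q e, f i p q e = coefz (g i p q) (e + (i.+1 * B)%:Z).
  elim: i => [|i [IHs IHc]].
    split=> p q; first by rewrite mxE mul1n size_poly.
    by move=> e; rewrite GE mul1n addrK.
  split=> p q.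
    rewrite mxE; apply: (big_ind (fun u : {poly K} => size u <= (2 * (i.+2 * B)).+1)%N).
    - by rewrite size_poly0.
    - by move=> u v su sv; rewrite (leq_trans (size_polyD _ _)) // geq_max su sv.
    move=> t _; apply: leq_trans (size_polyMleq _ _) _.
    have s1 := IHs p t; have : (size (G t q) <= (2 * B).+1)%N by rewrite mxE size_poly.
    move: s1; rewrite [(i.+2 * B)%N]mulSn; move: (i.+1 * B)%N (size _) (size _) => b u v.
    lia.
  move=> e; rewrite (fS i p q e (i.+1 * B)%N); last first.
    move=> t a ba; rewrite IHc; case E : (a + _) => [j|j] //=; rewrite nth_default //.
    by apply: leq_trans (IHs p t) _; lia.
  rewrite mxE coefz_sum; apply: eq_bigr => t _.
  rewrite (@coefz_mul _ _ _ (2 * (i.+1 * B)).+1) // /lmulN; apply: eq_bigr => j _.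
  rewrite IHc subrK /= GE; congr (_ * f _ _ _ _).
  rewrite [(i.+2 * B)%N]mulSn; move: (nat_of_ord j) => {j} j; move: (i.+1 * B)%N => b.
  lia.
pose h i := map_mx (@tofrac {poly K}) (g i).
have hm : h m = 0.
  apply/matrixP => p q; rewrite !mxE; apply/eqP; rewrite tofrac_eq0; apply/eqP/polyP => j.
  have := (gE m).2 p q (j%:Z - (m.+1 * B)%:Z); rewrite subrK fm /= => <-.
  by rewrite coef0.
have hS i : h i.+1 = h i *m h 0%N by rewrite -map_mxM.
have hk := mx_nilpotent_bound hS hm Nk.
move=> p q e; rewrite (gE k).2 (_ : g k p q = 0); first by case: (_ + _) => j //=; rewrite coef0.
by apply/eqP; rewrite -tofrac_eq0; have /matrixP/(_ p q) := hk; rewrite !mxE => ->.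
Qed.
End NilpotentMatrices.

Lemma decomp_nil_index (K : fieldType) (A : nalg K) gr n : (0 < n)%N ->
  gr_decomp_le (A := A) gr n -> nil_index_le A n.
Proof.
move=> n0 [I [J [ni [nj [di [tj [dj [phi [nin [njn [_ [iso _]]]]]]]]]]]].
case: iso => _ [phiZ [phiM [phiF [phiI _]]]] x [m xm].
have phi01 i : (phi 0).1 i = 0.
  by have [/(_ i) + _] := phiZ 0 0; rewrite scale0r => ->; rewrite scale0r.
have phi02 j p q e : (phi 0).2 j p q e = 0.
  by have [_ /(_ j p q e)] := phiZ 0 0; rewrite scale0r => ->; rewrite mul0r.
(* Positivity of [n] excludes the dummy value [napow x 0]; the index k now stands for the exponent k
   + 1, as in the bounds above. *)
case: n n0 nin njn => // n _ nin njn; apply: phiI; split=> [i|j p q e].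
  rewrite phi01; apply: (mx_nilpotent_bound (f := fun k => (phi (napow x k.+1)).1 i) (m := m)) => //.
  - by move=> k; have [/(_ i)] := phiM (napow x k.+1) x.
  - by rewrite xm.
rewrite phi02.
have [B BP] : exists B : nat, forall p q a, (B < absz a)%N -> (phi x).2 j p q a = 0.
  have [_ [_ /(_ j) bnd]] := phiF x.
  have /choice[bf bfP] : forall pq, exists b : nat, forall k, (b < absz k)%N -> (phi x).2 j pq.1 pq.2 k = 0.
    by move=> pq; apply: bnd.
  exists (\max_pq bf pq) => p' q' a Ba; apply: (bfP (p', q')); apply: leq_ltn_trans Ba.
  exact: (leq_bigmax (p', q')).
apply: (laurent_nilpotent_bound (f := fun k => (phi (napow x k.+1)).2 j) (B := B) (m := m)) => //.
- by move=> k p' q' e' b bP; have [_ /(_ j p' q' e' b bP)] := phiM (napow x k.+1) x.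
- by move=> p' q' e'; rewrite xm.
Qed.

(** * Graded semisimplicity *)

Section GradedSemisimple.
Variables (K : fieldType) (A : nalg K) (gr : int -> A -> Prop).
Variables (T : Type) (x y : T -> A).
Hypothesis yx0 : forall t u, t <> u -> y t ** x u = 0.
Hypothesis xyx : forall t, x t ** y t ** x t = x t.
Hypothesis yxy : forall t, y t ** x t ** y t = y t.
Hypothesis x_neq0 : forall t, x t <> 0.
Hypothesis unitl : forall a, exists l : seq T, a = \sum_(t <- l) x t ** y t ** a.
Hypothesis unitr : forall a, exists l : seq T, a = \sum_(t <- l) a ** (x t ** y t).
Hypothesis homog : forall a, exists k (c : 'I_k -> A) (dg : 'I_k -> int),
  (forall i, gr (dg i) (c i)) /\ a = \sum_(i < k) c i.
Hypothesis gr_xy : forall m a t, gr m a -> gr m (a ** (x t ** y t)).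
Hypothesis invertible : forall m a t u, gr m a -> y t ** a ** x u <> 0 ->
  exists g, g ** (y t ** a ** x u) = y u ** x u.

(** The left ideal generated by the idempotent x y, as the fixed points of right multiplication by
    it. Keeping [x] and [y] abstract allows them to be exchanged in the opposite algebra, which
    yields right ideals. *)
Let U t a := a ** (x t ** y t) = a.

Lemma xy_idem t : x t ** y t ** (x t ** y t) = x t ** y t.
Proof. by rewrite namulA xyx. Qed.

Lemma gr_ideal_generated t : is_gr_ideal gr true (U t).
Proof.
split.
  split; first by rewrite /U namul0l.
  split; first by move=> u v uE vE; rewrite /U namulDl uE vE.
  by split=> [a u uE|a u uE]; rewrite /U ?namulZl /= -?namulA ?uE.
move=> u uE; have [k [c [dg [cP cE]]]] := homog u.
exists k, (fun i => c i ** (x t ** y t)), dg; split=> [i|].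
  by split; [apply: gr_xy|rewrite /U -namulA xy_idem].
by rewrite -namul_suml -cE uE.
Qed.

(** A nonzero graded subideal contains a nonzero homogeneous c. Some y_t' c x_t is nonzero, and its
    left inverse puts [y t], hence the whole ideal, into the subideal. *)
Lemma gr_simple_generated t : is_gr_simple_ideal gr true (U t).
Proof.
split; first exact: gr_ideal_generated.
split.
  exists (x t ** y t); split; first exact: xy_idem.
  by move=> xy0; apply: (@x_neq0 t); rewrite -xyx xy0 namul0l.
move=> U' [[U'0 [U'D [U'Z U'M]]] U'gr] sub.
have [nz|] := pselect (exists u, U' u /\ u <> 0); last first.
  by move=> nnz; left => u U'u; apply: contrapT => u0; apply: nnz; exists u.
right; have [u0 [U'u0 u0n]] := nz; have [k [c [dg [cP cE]]]] := U'gr u0 U'u0.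
have [i ci] : exists i, c i <> 0.
  by apply: contrapT => nc; apply: u0n; rewrite cE big1 // => i _; apply: contrapT => ci; apply: nc; exists i.
have [gci U'ci] := cP i.
have [l lE] := unitl (c i).
have [t' yc] : exists t', y t' ** c i <> 0.
  apply: contrapT => ny; apply: ci; rewrite lE big1 // => t' _; rewrite -namulA.
  by have [->|yc] := pselect (y t' ** c i = 0); [rewrite namul0r|case: ny; exists t'].
have ciE := sub _ U'ci.
have bn : y t' ** c i ** x t <> 0.
  by move=> b0; apply: yc; rewrite -ciE !namulA b0 namul0l.
have [g gE] := invertible gci bn.
have U'y : U' (y t).
  rewrite -yxy -gE; have := U'M (g ** y t') _ U'ci.
  by rewrite /side_mul -{1}ciE !namulA.
by move=> u <-; rewrite namulA; apply: (U'M (u ** x t)).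
Qed.

(** The sum is direct because right multiplication by one idempotent kills the other ideals. *)
Lemma gr_semisimple_family : gr_semisimple gr true.
Proof.
exists T, U; split; first exact: gr_simple_generated.
split=> [a|k idx u inj uE u0 i].
  have [l lE] := unitr a.
  exists (size l), (tnth (in_tuple l)), (fun i => a ** (x (tnth (in_tuple l) i) ** y (tnth (in_tuple l) i))).
  split=> [i|]; first by rewrite /U -namulA xy_idem.
  by rewrite {1}lE big_tnth.
have := congr1 (fun z => z ** (x (idx i) ** y (idx i))) u0.
rewrite /= namul0l namul_suml (bigD1 i) //= uE big1 ?addr0 // => j ji.
rewrite -uE -namulA [_ ** (x (idx i) ** _)]namulA -[x (idx j) ** _ ** _]namulA yx0 ?namul0r ?namul0l ?namul0r //.
by move/inj => jiE; rewrite jiE eqxx in ji.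
Qed.
End GradedSemisimple.

(** * Graphs of bounded index *)

(* The matrix units [x i ** y j] contain a Jordan block of size [k]. *)
Lemma orthogonal_family_le (K : fieldType) (A : nalg K) n k (x y : nat -> A) (w : A) :
  nil_index_le A n -> (0 < n)%N -> w <> 0 ->
  (forall i, w ** y i = y i) ->
  (forall i, (i < k)%N -> y i ** x i = w) ->
  (forall i j, (i < k)%N -> (j < k)%N -> i <> j -> y i ** x j = 0) ->
  (k <= n)%N.
Proof.
move=> nilA n0 w0 wy yx yx0; rewrite leqNgt; apply/negP => nk.
(* The indices run from 0 to [n], which requires n + 1 units. Each power shifts the second index by
   one more: the n-th power is x_0 y_n, the next one is an empty sum. *)
pose a := \sum_(0 <= i < n) x i ** y i.+1.
have powE m : napow a m.+1 = \sum_(0 <= i < n - m) x i ** y (i + m.+1)%N.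
  elim: m => [|m IH].
    by rewrite subn0; apply: eq_bigr => i _; rewrite addn1.
  rewrite napowS IH namul_suml.
  have [mn|mn] := ltnP m n; last first.
    by rewrite !big_geq //; lia.
  rewrite (_ : (n - m)%N = (n - m.+1).+1) ?big_nat_recr //=; last by lia.
  rewrite [X in _ + X](_ : _ = 0) ?addr0.
    rewrite big_nat [RHS]big_nat; apply: eq_bigr => i /andP[_ im].
    rewrite namul_sumr (bigD1_seq (i + m.+1)%N) ?iota_uniq ?mem_index_iota //=; last by lia.
    rewrite big1_seq ?addr0; first by rewrite -namulA [y _ ** _]namulA yx ?wy ?addnS //; lia.
    move=> j; rewrite mem_index_iota => /andP[jm /andP[_ jn]].
    by rewrite -namulA [y _ ** _]namulA yx0 ?namul0l ?namul0r //; lia.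
  rewrite namul_sumr big_nat big1 // => j /andP[_ jn].
  by rewrite -namulA [y _ ** _]namulA yx0 ?namul0l ?namul0r //; lia.
have an0 : napow a n = 0.
  by apply: nilA; exists n; rewrite powE subnn big_geq.
move: (powE n.-1); rewrite prednK // an0 (_ : (n - n.-1)%N = 1%N); last by lia.
rewrite big_nat1 add0n => xy0; apply: w0.
have := congr1 (fun z => y 0%N ** z ** x n) xy0.
by rewrite /= namul0r namul0l namulA yx ?wy ?yx //; lia.
Qed.

Section BoundedIndex.
Variables (K : fieldType) (V Ed : eqType) (s r : Ed -> V).
Hypothesis Hrf : row_finite s.
Variables (L : nalg K) (P : V -> L) (S Ss : Ed -> L).
Hypothesis HL : is_LPA s r P S Ss.
Notation src := (src s).
Notation is_path := (is_path s r).
Notation sink := (sink s).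
Notation pX := (pX P S).
Notation pY := (pY P Ss).

(** [P v] acts as restriction to the paths starting at [v]; it is tested on the constant function 1
    at one such path. *)
Lemma vert_neq0 v : P v <> 0.
Proof.
move=> Pv0; have [_ univ] := HL.
have [[h [hh [hP _]]] _] := univ _ _ _ _ (@rep_family K V Ed s r).
have [x [mx x0]] := maximal_exists s r v.
have := congr1 (fun f => endo_eval (f : endo_nalg _) (fun _ => 1) (x, 0)) (hP v).
rewrite wcompE Pv0 (nalg_hom0 hh) /= x0 eqxx (asboolT mx) /=.
by move/eqP; rewrite eq_sym oner_eq0.
Qed.

Lemma out_edges v : exists l, uniq l /\ (forall e, (e \in l) = (s e == v)).
Proof.
have [l lP] := Hrf v; exists (undup [seq e <- l | s e == v]).
rewrite undup_uniq; split=> // e; rewrite mem_undup mem_filter.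
by case: eqP => //= /lP/InP.
Qed.

Lemma vert_sum v (l : seq Ed) : ~ sink v -> uniq l -> (forall e, (e \in l) = (s e == v)) ->
  P v = \sum_(e <- l) S e ** Ss e.
Proof.
move=> nv ul lP; have [[_ [_ [_ [_ [_ [_ CK]]]]]] _] := HL.
apply: CK; first exact: NoDupP.
  by move=> e; rewrite InP lP; split=> /eqP.
move=> l0; apply: nv => e /eqP; rewrite -lP l0.
by [].
Qed.

Variable n : nat.
Hypotheses (n_gt0 : (0 < n)%N) (nilL : nil_index_le L n).

Lemma paths_le w k (p : nat -> seq Ed) :
  (forall i, (i < k)%N -> is_path (p i) w) ->
  (forall i j, (i < k)%N -> (j < k)%N -> i <> j -> pY (p i) w ** pX (p j) w = 0) ->
  (k <= n)%N.
Proof.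
move=> pw p0.
apply: (orthogonal_family_le (x := fun i => pX (p i) w) (y := fun i => pY (p i) w)
          nilL n_gt0 (@vert_neq0 w)) => //.
- by move=> i; apply: (end_pY HL).
- by move=> i ik; apply: (pY_pX_same HL); apply: pw.
Qed.

(** * Cycles without exits and terminal vertices *)

Definition cyc v := exists e l, is_path (e :: l) v /\ s e = v.

(** An exit g from a cycle c yields the paths c^k g for all k. They are pairwise incomparable and
    share the range of g, so n + 1 of them contradict the bound. *)
Lemma cyc_out v e f : cyc v -> s e = v -> s f = v -> e = f.
Proof.
suff H e0 l g : is_path (e0 :: l) v -> s e0 = v -> s g = v -> g = e0.
  by move=> [e0 [l [pl se0]]] se sf; rewrite (H e0 l e) // (H e0 l f).
move=> pl se0 sg; apply/eqP/negPn/negP => ge0.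
pose c k := flatten (nseq k (e0 :: l)).
have cS k : c k.+1 = (e0 :: l) ++ c k by [].
have cP k : is_path (c k) v /\ src (c k) v = v.
  elim: k => [|k [IH1 IH2]] //; rewrite cS is_path_cat src_cat IH2 IH1.
  by rewrite pl /= se0.
have cD i j : c (i + j)%N = c i ++ c j by rewrite /c nseqD flatten_cat.
have nle : (n.+1 <= n)%N; last by rewrite ltnn in nle.
apply: (@paths_le (r g) n.+1 (fun k => c k ++ [:: g])) => [i _|i j _ _ ij].
  by rewrite is_path_cat /= sg (cP i).1 eqxx.
have np a b : a <> b -> ~~ prefix (c a ++ [:: g]) (c b ++ [:: g]).
  move=> ab; have [lt_ab|le_ba] := ltnP a b.
    rewrite -(subnKC lt_ab) addSnnS cD -catA prefix_catr // eqxx /= (negbTE ge0) //.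
  have lt_ba : (b < a)%N by lia.
  rewrite -(subnKC lt_ba) addSnnS cD -catA prefix_catr // eqxx /= eq_sym (negbTE ge0) //.
by apply: (pY_pX0 HL); apply: np => // /esym.
Qed.

Lemma cyc_step e : cyc (s e) -> cyc (r e).
Proof.
move=> cv; have [e0 [l [/= /andP[/eqP re0 pl] se0]]] := cv.
have ee0 := cyc_out cv erefl se0; subst e0.
case: l re0 pl => [|f l] /= re0 pl.
  by exists e, [::]; rewrite /= re0 eqxx.
exists f, (rcons l e); rewrite -cats1 -re0; split=> //.
have := is_path_cat s r (f :: l) [:: e] (r e).
by rewrite [is_path [:: e] _]/= eqxx andbT /= => ->; rewrite andbT pl.
Qed.

Lemma cyc_path l w : cyc (src l w) -> is_path l w -> cyc w.
Proof.
elim: l => //= e l IH ce /andP[/eqP re pl]; apply: IH => //.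
by rewrite -re; apply: cyc_step.
Qed.

Definition reach v w := exists l, is_path l w /\ src l w = v.

Lemma reach_trans u v w : reach u v -> reach v w -> reach u w.
Proof.
move=> [l [pl lu]] [m [pm mv]]; exists (l ++ m).
by rewrite is_path_cat src_cat mv pl pm lu.
Qed.

Lemma reach_exists v : exists w, reach v w.
Proof. by exists v, [::]. Qed.

(** Without exits a path from a vertex of a cycle stays on that cycle, and the remaining edges of
    the cycle lead back. *)
Lemma cyc_back v w : cyc v -> reach v w -> reach w v.
Proof.
move=> + [l [+ lv]]; elim: l v lv => [|e l IH] v /=; first by move=> <- _; exists [::].
move=> se cv /andP[/eqP re pl].
have [e0 [l0 [/= /andP[/eqP re0 pl0] se0]]] := cv.
have ee0 : e = e0 by apply: (cyc_out cv).
apply: (@reach_trans _ (r e)).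
  by apply: IH => //; apply: cyc_step; rewrite se.
by exists l0; rewrite ee0 -re0.
Qed.

(* A canonical vertex on each cycle: it only depends on the set of vertices
   reachable from [v], which is the same for all vertices of the cycle. *)
Definition root v := projT1 (cid (reach_exists v)).

Lemma reach_root v : reach v (root v).
Proof. by rewrite /root; case: cid. Qed.

Lemma root_eq v w : cyc v -> reach v w -> root v = root w.
Proof.
move=> cv vw; rewrite /root; have vwE : reach v = reach w.
  apply/funext => u; apply/propext; split; last exact: reach_trans.
  by apply: reach_trans; apply: cyc_back.
(* The choice depends on the predicate and on the existence proof; the predicates are equal, and
   irrelevance identifies the proofs. *)
move: (reach_exists v) (reach_exists w); rewrite vwE => h1 h2.
by rewrite (Prop_irrelevance h1 h2).
Qed.

Definition base w := cyc w /\ root w = w.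
Definition term w := sink w \/ base w.

Lemma base_root v : cyc v -> base (root v).
Proof.
move=> cv; split; last by rewrite -(root_eq cv (reach_root v)).
by have [l [pl lv]] := reach_root v; apply: cyc_path pl; rewrite lv.
Qed.

Lemma cyc_nsink v : cyc v -> ~ sink v.
Proof. by move=> [e [l [_ <-]]]; apply. Qed.

(** Only the trivial path leaves a sink, and vertices of one cycle have the same root. *)
Lemma term_reach v w : term v -> term w -> reach v w -> v = w.
Proof.
move=> [sv _ [[|e l] [//= _ ev]]|[cv rv] tw vw]; first by case: (sv e).
have [l [pl lv]] := vw.
have cw : cyc w by apply: cyc_path pl; rewrite lv.
case: tw => [/(cyc_nsink cw)//|[_ <-]].
by rewrite -rv; apply: root_eq.
Qed.

(** After a terminal vertex there is never a choice of edge. Hence prepending a closed path to the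
    maximal path at [w] gives that path back. *)
Lemma term_maximal_uniq w x y : term w -> maximal s r x -> maximal s r y ->
  (x 0%N).1 = w -> (y 0%N).1 = w -> x = y.
Proof.
move=> tw mx my x0 y0.
have edge v z i : maximal s r z -> (z i).1 = v -> cyc v ->
    exists e, [/\ s e = v, z i = (v, Some e) & (z i.+1).1 = r e].
  move=> mz zv cv; have := mz i; rewrite zv; case E : (z i) zv => [u [e|]] /= uv.
    by case=> se <-; exists e; rewrite uv.
  by case=> /(cyc_nsink cv).
have step i : (x i).1 = (y i).1 -> sink (x i).1 \/ cyc (x i).1 ->
    [/\ x i = y i, (x i.+1).1 = (y i.+1).1 & sink (x i.+1).1 \/ cyc (x i.+1).1].
  move=> xy [sx|cx].
    have := mx i; have := my i; rewrite -xy.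
    case E : (x i) sx xy => [u [e|]] /= sx xy; first by move=> _ [/sx].
    case F : (y i) xy => [u' [e|]] /= xy; first by case=> [/sx].
    by case=> _ -> [_ ->]; rewrite xy; split=> //; left; rewrite -xy.
  have [e [se xi xi1]] := edge _ x i mx erefl cx.
  have [f [sf yi yi1]] := edge _ y i my (esym xy) cx.
  have ef : e = f by apply: (cyc_out cx).
  rewrite xi yi xi1 yi1 ef /=; split=> //; right; apply: cyc_step.
  by rewrite sf.
have all i : (x i).1 = (y i).1 /\ (sink (x i).1 \/ cyc (x i).1).
  elim: i => [|i [xy tx]]; last by have [] := step i xy tx.
  by rewrite x0 y0; split=> //; case: tw => [|[]]; [left|right].
by apply/funext => i; have [xy tx] := all i; have [] := step i xy tx.
Qed.

(** * First-arrival paths and the decomposition of vertices *)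

Definition first_arrival (t : V * seq Ed) :=
  is_path t.2 t.1 && all (fun e => s e != t.1) t.2.

Definition tpath t := term t.1 /\ first_arrival t.

Notation tX t := (pX t.2 t.1).
Notation tY t := (pY t.2 t.1).
Notation tsrc t := (src t.2 t.1).

Lemma tpath_path t : tpath t -> is_path t.2 t.1.
Proof. by case=> _ /andP[]. Qed.

(** The remaining part of the longer path joins two terminal vertices, so they coincide; a nonempty
    remainder would then leave the range of the longer path before its end. *)
Lemma tpath_prefix t u : tpath t -> tpath u -> tsrc t = tsrc u -> prefix t.2 u.2 -> t = u.
Proof.
case: t u => [v p] [w q] [/= tv /andP[/= pv _]] [/= tw /andP[/= qw aq]] pq /prefixP[m qE].
subst q; move: qw; rewrite is_path_cat => /andP[pm mw].
have vm : v = src m w by apply: (is_path_end pv pm); rewrite -src_cat.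
have vw : v = w by apply: term_reach => //; exists m.
case: m vm aq {pm mw pq} => [|e m] /= vm aq; first by rewrite vw cats0.
by move: aq; rewrite all_cat /= -vm vw eqxx /= andbF.
Qed.

Lemma tpath_orth t u : tpath t -> tpath u -> t <> u -> tY t ** tX u = 0.
Proof.
move=> tt tu ntu.
have [tsu|] := pselect (tsrc t = tsrc u); last exact: (pY_pX_src0 HL).
apply: (pY_pX0 HL); apply/negP => pr; apply: ntu; first exact: tpath_prefix.
by apply/esym/tpath_prefix.
Qed.

Lemma tpath_id t : tpath t -> tY t ** tX t = P t.1.
Proof. by move=> /tpath_path tt; apply: (pY_pX_same HL). Qed.

Definition decomposes v l :=
  [/\ uniq l, (forall t, t \in l -> tpath t /\ tsrc t = v) &
      P v = \sum_(t <- l) tX t ** tY t].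

Lemma decomposes_term v : term v -> decomposes v [:: (v, [::])].
Proof.
move=> tv; split=> //; last by rewrite big_seq1 (vert_idem HL).
by move=> t; rewrite inE => /eqP ->.
Qed.

Lemma decomposes_step v : ~ term v ->
  (forall e, s e = v -> exists l, decomposes (r e) l) -> exists l, decomposes v l.
Proof.
move=> ntv dec.
have /choice[ls lsP] : forall e, exists l, s e = v -> decomposes (r e) l.
  move=> e; have [/dec[l]|] := pselect (s e = v); first by exists l.
  by exists [::].
have [out [uo oP]] := out_edges v.
exists [seq (t.1, e :: t.2) | e <- out, t <- ls e]; split.
- apply: allpairs_uniq_dep => //.
    by move=> e; rewrite oP => /eqP /lsP[].
  by move=> [e [w p]] [e' [w' p']] _ _ /= [-> -> ->].
- move=> t /allpairsPdep[e [[w p] [eo pl ->]]].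
  move: eo; rewrite oP => /eqP se; have [_ /(_ _ pl)[[/= tw /andP[/= pw aw]] sp] _] := lsP e se.
  split=> //=; split=> //=; apply/andP; rewrite /= pw aw sp eqxx; split=> //.
  (* The added edge starts at [v], which differs from the terminal range because [v] is not
     terminal: the longer path is still a first arrival. *)
  by rewrite andbT; apply/eqP => ew; apply: ntv; rewrite -se ew.
- rewrite big_allpairs_dep (@vert_sum v out) //; last first.
    by move=> sv; apply: ntv; left.
  apply: eq_big_seq => e; rewrite oP => /eqP se.
  have [_ _ Pr] := lsP e se.
  rewrite -{1}(edge_vert HL e) Pr namul_sumr namul_suml.
  by apply: eq_bigr => t _; rewrite /= !namulA.
Qed.

(** No measure decreases along edges. Instead, a vertex without decomposition starts an infinite
    walk through such vertices; the walk enters a cycle and therefore meets its root, which is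
    terminal and so decomposes. *)
Lemma decomposition v : exists l, decomposes v l.
Proof.
apply: contrapT => nd0.
pose D u := exists l, decomposes u l.
have nterm u : ~ D u -> ~ term u.
  by move=> nD tu; apply: nD; exists [:: (u, [::])]; apply: decomposes_term.
have next u : ~ D u -> exists e, s e = u /\ ~ D (r e).
  move=> nD; apply: contrapT => nex; apply: (nD); apply: decomposes_step; first exact: nterm.
  by move=> e se; apply: contrapT => nr; apply: nex; exists e.
have [edef _] := next v nd0.
have /choice[f fP] : forall u, exists e, ~ D u -> s e = u /\ ~ D (r e).
  move=> u; have [Du|/next[e eP]] := pselect (D u); first by exists edef.
  by exists e.
pose vs i := iter i (r \o f) v.
have nD i : ~ D (vs i) by elim: i => //= i IH; case: (fP _ IH).
have sf i : s (f (vs i)) = vs i by case: (fP _ (nD i)).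
pose p i m := [seq f (vs j) | j <- iota i m].
have pP i m : is_path (p i m) (vs (i + m)%N) /\ src (p i m) (vs (i + m)%N) = vs i.
  elim: m i => [|m IH] i; first by rewrite addn0.
  have [IH1 IH2] := IH i.+1; rewrite -addSnnS /p /= IH1 sf; split=> //.
  by rewrite andbT -/(p _ _) IH2.
(* If the walk did not repeat, its segments from step i to step [n], for i from 0 to [n], would have
   distinct sources and a common range: n + 1 orthogonal paths. *)
have [i [j [ij vij]]] : exists i j, (i < j)%N /\ vs i = vs j.
  apply: contrapT => inj; have nle : (n.+1 <= n)%N; last by rewrite ltnn in nle.
  apply: (@paths_le (vs n) n.+1 (fun i => p i (n - i)%N)) => [i|i j] ni.
    by have := (pP i (n - i)%N).1; rewrite subnKC.
  move=> nj ij; apply: (pY_pX_src0 HL) => e; apply: inj.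
  have [i' i'E] := pP i (n - i)%N; have [j' j'E] := pP j (n - j)%N.
  move: i'E j'E; rewrite !subnKC // => i'E j'E; rewrite i'E j'E in e.
  by case: (ltngtP i j) ij => // ij _; [exists i, j|exists j, i].
have cvi : cyc (vs i).
  have [pl ps] := pP i (j - i)%N; move: pl ps; rewrite subnKC ?(ltnW ij) //.
  case E : (p i (j - i)%N) => [|e l]; last by rewrite vij => pl ps; exists e, l.
  by move/(congr1 size): E; rewrite size_map size_iota /= => jE; lia.
(* Since cycles have no exits, every path from a cyclic vertex of the walk follows the walk. *)
have along l w k : cyc (vs k) -> is_path l w -> src l w = vs k -> exists k', w = vs k'.
  elim: l k => [|e l IH] k /= ck; first by move=> _ ->; exists k.
  move=> /andP[/eqP re pl] se; apply: (IH k.+1) => //.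
    by rewrite /= -(cyc_out ck se (sf k)); apply: cyc_step; rewrite se.
  by rewrite -re /= (cyc_out ck se (sf k)).
have [l [pl lv]] := reach_root (vs i).
have [k rk] := along _ _ _ cvi pl lv.
by apply: (nterm _ (nD k)); rewrite -rk; right; apply: base_root.
Qed.

(** * Local units and corners *)

Definition eunit l := \sum_(t <- l) tX t ** tY t.

Definition tpaths l := uniq l /\ forall t, t \in l -> tpath t.

Lemma tY_eunit l t : tpaths l -> t \in l -> tY t ** eunit l = tY t.
Proof.
move=> [ul tl] lt; have tt := tl t lt.
rewrite namul_sumr (bigD1_seq t) //= namulA (tpath_id tt) (end_pY HL).
rewrite big1_seq ?addr0 // => u /andP[/eqP ut lu].
by rewrite namulA (tpath_orth tt (tl u lu)) ?namul0l // => /esym.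
Qed.

Lemma eunit_tX l t : tpaths l -> t \in l -> eunit l ** tX t = tX t.
Proof.
move=> [ul tl] lt; have tt := tl t lt.
rewrite namul_suml (bigD1_seq t) //= -namulA (tpath_id tt) (pX_end HL).
rewrite big1_seq ?addr0 // => u /andP[/eqP ut lu].
by rewrite -namulA (tpath_orth (tl u lu) tt) ?namul0r.
Qed.

Lemma local_unit a : exists2 l, tpaths l & eunit l ** a = a /\ a ** eunit l = a.
Proof.
(* Asking for a unit on every larger family makes the property stable under sums and products, where
   the families are merged. *)
pose U a := exists2 l : seq (V * seq Ed), (forall t, t \in l -> tpath t) &
  forall l', tpaths l' -> {subset l <= l'} -> eunit l' ** a = a /\ a ** eunit l' = a.
suff [l tl aE] : U a.
  have tul : tpaths (undup l) by split; [exact: undup_uniq|move=> t; rewrite mem_undup; apply: tl].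
  by exists (undup l) => //; apply: aE => // t; rewrite mem_undup.
have subl (l1 l2 l : seq (V * seq Ed)) : {subset l1 ++ l2 <= l} ->
    {subset l1 <= l} /\ {subset l2 <= l}.
  by move=> sl; split=> t tl; apply: sl; rewrite mem_cat tl ?orbT.
have UP v : U (P v).
  have [l [ul tl PE]] := decomposition v.
  exists l => [t /tl[]//|l' tl' ll'].
  rewrite PE namul_sumr namul_suml; split; apply: eq_big_seq => t /ll' lt.
    by rewrite namulA eunit_tX.
  by rewrite -namulA tY_eunit.
have Ubetween u v b : P u ** b = b -> b ** P v = b -> U b.
  move=> ub bv; have [[lu tu uE] [lv tv vE]] := (UP u, UP v).
  exists (lu ++ lv) => [t|l tl /subl[sl1 sl2]].
    by rewrite mem_cat => /orP[/tu|/tv].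
  split; first by rewrite -ub namulA (uE l tl sl1).1.
  by rewrite -bv -namulA (vE l tl sl2).2.
apply: (LPA_ind HL) a.
- by exists [::] => // l' _ _; rewrite namul0l namul0r.
- move=> x y [l tl lE] [m tm mE]; exists (l ++ m) => [t|l' tl' /subl[s1 s2]].
    by rewrite mem_cat => /orP[/tl|/tm].
  by rewrite namulDl namulDr (lE l' tl' s1).1 (lE l' tl' s1).2 (mE l' tl' s2).1 (mE l' tl' s2).2.
- move=> b x [l tl lE]; exists l => // l' tl' s1.
  by rewrite namulZl namulZr (lE l' tl' s1).1 (lE l' tl' s1).2.
- move=> x y [l tl lE] [m tm mE]; exists (l ++ m) => [t|l' tl' /subl[s1 s2]].
    by rewrite mem_cat => /orP[/tl|/tm].
  by rewrite namulA (lE l' tl' s1).1 -namulA (mE l' tl' s2).2.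
- exact: UP.
- by move=> e; apply: (Ubetween (s e) (r e)); [exact: vert_edge HL _|exact: edge_vert HL _].
- by move=> e; apply: (Ubetween (r e) (s e)); [exact: vert_ghost HL _|exact: ghost_vert HL _].
Qed.

Lemma term_back w z : term w -> reach w z -> reach z w.
Proof.
move=> [sw [l [pl lw]]|[cw _]]; last exact: cyc_back.
by case: l pl lw => [_ /= ->|e l _ /= /sw//]; exists [::].
Qed.

(** A nonzero monomial in this corner has a middle vertex reached from both [w] and [w']. A terminal
    vertex can be reached back from there, so the two are joined by a path. *)
Lemma corner0 w w' b : term w -> term w' -> w <> w' -> P w ** b ** P w' = 0.
Proof.
move=> tw tw' ww'; apply: (lspan_linear0 (f := fun b => P w ** b ** P w') _ _ _ (lspan_pXY HL b)).
- by move=> x y; rewrite namulDr namulDl.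
- by move=> a x; rewrite namulZr namulZl.
move=> _ [l [m [z [pl pm ->]]]]; rewrite namulA.
have [wl|wl] := pselect (w = src l z); last by rewrite (vert_pX0 HL) // !namul0l.
have [wm|wm] := pselect (w' = src m z); last by rewrite -[_ ** P w']namulA (pY_vert0 HL) ?namul0r.
case: ww'; apply/esym/term_reach => //; apply: (@reach_trans _ z); first by exists m.
by apply: term_back => //; exists l.
Qed.

Lemma cross0 t u a : tpath t -> tpath u -> t.1 <> u.1 -> tY t ** a ** tX u = 0.
Proof.
move=> [tt _] [tu _] tu1.
rewrite -(end_pY HL) -(pX_end HL u.2) -!namulA [_ ** (a ** _)]namulA.
by rewrite [(_ ** _) ** _]namulA [P _ ** _]namulA corner0.
Qed.

(** A vertex of a cycle emits a single edge, so the sum relation there reads v = e e^*. *)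
Lemma cyc_unitary l w : cyc (src l w) -> is_path l w -> pX l w ** pY l w = P (src l w).
Proof.
elim: l => [|e l IH] /= ce; first by rewrite (vert_idem HL).
move=> /andP[/eqP re pl]; rewrite namulA -[_ ** _ ** pY _ _]namulA IH //; last first.
  by rewrite -re; apply: cyc_step.
rewrite -re (edge_vert HL) (@vert_sum (s e) [:: e]) ?big_seq1 //; first exact: cyc_nsink.
by move=> f; rewrite inE; apply/eqP/eqP => [->//|sf]; apply: (cyc_out ce).
Qed.

Lemma term_unitary l w : term (src l w) -> is_path l w -> pX l w ** pY l w = P (src l w).
Proof.
move=> [sl|[cl _]]; last exact: cyc_unitary.
by case: l sl => [|e l] /= sl _; [rewrite (vert_idem HL)|case: (sl e)].
Qed.

Lemma cyc_prefix l z m z' : cyc (src l z) -> src l z = src m z' ->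
  is_path l z -> is_path m z' -> (size l <= size m)%N -> prefix l m.
Proof.
elim: l m => [|e l IH] [|f m] //= ce ef /andP[/eqP re pl] /andP[/eqP rf pm] lm.
have efE : e = f by apply: (cyc_out ce).
rewrite efE eqxx /=; apply: IH => //; first by rewrite -re; apply: cyc_step.
by rewrite -re -rf efE.
Qed.

(** * Closed paths and powers of cycles *)

Definition closed_path l w := is_path l w /\ src l w = w.
Definition rep_path k (c : seq Ed) := flatten (nseq k c).

(** The premise stands under the existential to make [cycle] a total function. At a base point a
    shortest nontrivial closed path is a prefix of every other one, for lack of exits, and is split
    off repeatedly. *)
Lemma term_cycle w : exists c, term w ->
  [/\ closed_path c w, base w -> c <> [::] &
      forall l, closed_path l w -> exists k, l = rep_path k c].
Proof.
have [tw|] := pselect (term w); last by exists [::].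
case: tw => [sw|bw].
  exists [::] => _; split=> //; first by move=> [/cyc_nsink].
  by move=> [|e l] [/= _ el]; [exists 0%N|case: (sw e)].
have [cw _] := bw.
pose Q k := `[< exists l, closed_path l w /\ size l = k.+1 >].
have exQ : exists k, Q k.
  by have [e [l [pl sl]]] := cw; exists (size l); apply/asboolP; exists (e :: l).
case: (ex_minnP exQ) => k /asboolP[c [[pc cE] sc]] kmin.
exists c => _; split=> // [_ c0|l]; first by rewrite c0 in sc.
have [N] := ubnP (size l); elim: N l => // N IH l lN [pl lw].
case: (posnP (size l)) => [/size0nil ->|l0]; first by exists 0%N.
have cl : prefix c l.
  apply: (@cyc_prefix c w l w); rewrite ?cE ?lw // sc.
  by rewrite -[size l]prednK // ltnS kmin //; apply/asboolP; exists l; rewrite prednK.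
case/prefixP: cl => l' lE; subst l.
move: pl lw; rewrite is_path_cat src_cat => /andP[pc' pl'] cw'.
have l'w : src l' w = w by apply: (is_path_end pc' pc); rewrite cE.
have [|//|j ->] := IH l'; first by move: lN; rewrite size_cat sc; lia.
by exists j.+1.
Qed.

Definition cycle w := projT1 (cid (term_cycle w)).
Definition period w := size (cycle w).

Lemma cycleP w : term w ->
  [/\ closed_path (cycle w) w, base w -> cycle w <> [::] &
      forall l, closed_path l w -> exists k, l = rep_path k (cycle w)].
Proof. by rewrite /cycle; case: cid. Qed.

Lemma period_gt0 w : base w -> (0 < period w)%N.
Proof.
move=> bw; have [_ /(_ bw) + _] := cycleP (or_intror bw).
by rewrite /period; case: (cycle w).
Qed.

Lemma period_sink w : sink w -> period w = 0%N.
Proof.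
move=> sw; have [[pc cw] _ _] := cycleP (or_introl sw).
by rewrite /period; case: (cycle w) cw => // e l /sw.
Qed.

Lemma rep_path_closed w k : term w -> closed_path (rep_path k (cycle w)) w.
Proof.
move=> tw; have [[pc cw] _ _] := cycleP tw.
elim: k => // k [IH1 IH2]; rewrite /closed_path /rep_path /= is_path_cat src_cat.
by rewrite -/(rep_path _ _) IH2 IH1 pc cw.
Qed.

Lemma size_rep_path k c : size (rep_path k c) = (k * size c)%N.
Proof. by rewrite size_flatten /shape map_nseq sumn_nseq mulnC. Qed.

Definition cpow w (k : int) : L :=
  match k with
  | Posz i => pX (rep_path i (cycle w)) w
  | Negz i => pY (rep_path i.+1 (cycle w)) w
  end.

Lemma cpowN w (k : nat) : cpow w (- k%:Z) = pY (rep_path k (cycle w)) w.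
Proof. by case: k => //= k; rewrite -NegzE. Qed.

Lemma cpow_unit w k : term w -> cpow w (- k) ** cpow w k = P w /\ cpow w k ** cpow w (- k) = P w.
Proof.
move=> tw; have [i kE] : exists i : nat, k = i%:Z \/ k = - i%:Z.
  by exists `|k|%N; lia.
have [pi si] := rep_path_closed i tw.
have YX := pY_pX_same HL pi.
have XY : pX (rep_path i (cycle w)) w ** pY (rep_path i (cycle w)) w = P w.
  by rewrite term_unitary ?si.
by case: kE => ->; rewrite ?opprK cpowN /=.
Qed.

Lemma pXY_cpow w i j : term w ->
  pX (rep_path i (cycle w)) w ** pY (rep_path j (cycle w)) w = cpow w (i%:Z - j%:Z).
Proof.
move=> tw; have rD a b : rep_path (a + b) (cycle w) = rep_path a (cycle w) ++ rep_path b (cycle w).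
  by rewrite /rep_path nseqD flatten_cat.
have cl k := rep_path_closed k tw.
have XY k : pX (rep_path k (cycle w)) w ** pY (rep_path k (cycle w)) w = P w.
  by have [pk sk] := cl k; rewrite term_unitary ?sk.
have XD a b : pX (rep_path (a + b) (cycle w)) w = pX (rep_path a (cycle w)) w ** pX (rep_path b (cycle w)) w.
  by rewrite rD -(pX_cat HL) (cl b).2.
have YD a b : pY (rep_path (a + b) (cycle w)) w = pY (rep_path b (cycle w)) w ** pY (rep_path a (cycle w)) w.
  by rewrite rD -(pY_cat HL) (cl b).2.
have [ij|ji] := leqP j i.
  rewrite -{1}(subnK ij) XD -namulA XY (pX_end HL).
  by rewrite (_ : i%:Z - j%:Z = (i - j)%N) //; lia.
rewrite -{1}(subnK (ltnW ji)) YD namulA XY (end_pY HL) -cpowN.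
by congr cpow; lia.
Qed.

Definition is_cpow w x := exists k, x = cpow w k.

Lemma corner_lspan w b : term w -> P w ** b ** P w = b -> lspan (is_cpow w) b.
Proof.
move=> tw <-; elim: (lspan_pXY HL b) => [|a _ x [l [m [z [pl pm ->]]]] _ IH].
  by rewrite namul0r namul0l; apply: lspan0.
rewrite namulDr namulDl; apply: lspanD => //; rewrite namulZr namulZl; apply: lspanZ.
rewrite namulA.
have [wl|wl] := pselect (w = src l z); last by rewrite (vert_pX0 HL) // !namul0l; apply: lspan0.
have [wm|wm] := pselect (w = src m z); last first.
  by rewrite -[_ ** P w]namulA (pY_vert0 HL) ?namul0r //; apply: lspan0.
(* Inserting q q^* = P z in the middle of l m^* turns both factors into closed paths at [w], that
   is, powers of the cycle. *)
have [q [pq qz]] : reach z w by apply: term_back => //; exists l.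
have Pz : pX q w ** pY q w = P z.
  case: tw => [sw|[cw _]].
    case: l wl {pl} => [/= wz|e l /= /esym /sw//].
    by rewrite -qz; apply: term_unitary => //; left; rewrite qz -wz.
  by rewrite -qz; apply: cyc_unitary => //; rewrite qz; apply: (cyc_path _ pl); rewrite -wl.
have [_ _ gen] := cycleP tw.
have cl1 : closed_path (l ++ q) w by split; rewrite ?is_path_cat ?src_cat qz ?pl.
have cl2 : closed_path (m ++ q) w by split; rewrite ?is_path_cat ?src_cat qz ?pm.
have [i iE] := gen _ cl1; have [j jE] := gen _ cl2.
apply: lspan_gen; exists (i%:Z - j%:Z); rewrite -pXY_cpow // -iE -jE.
rewrite -(pX_cat HL) -(pY_cat HL) qz.
rewrite {1}wl (src_pX HL) -namulA {1}wm (pY_src HL) -[pX l z in LHS](pX_end HL) -Pz.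
by rewrite !namulA.
Qed.

(** * Coefficients of corner elements *)

Notation Z := (tail_seq V Ed * int)%type.
Notation M := (Z -> K^o).

Lemma rep_exists : exists h : L -> endo_nalg M, nalg_hom h /\
  (forall v, h (P v) = repP K s r v) /\
  (forall e, h (S e) = repS K s r e /\ h (Ss e) = repSs K s r e).
Proof. by case: HL => _ univ; case: (univ _ _ _ _ (@rep_family K V Ed s r)). Qed.

Definition rep := projT1 (cid rep_exists).

Lemma repE : nalg_hom rep /\ (forall v, rep (P v) = repP K s r v) /\
  (forall e, rep (S e) = repS K s r e /\ rep (Ss e) = repSs K s r e).
Proof. by rewrite /rep; case: cid. Qed.

Lemma rep_mul a b g : endo_eval (rep (a ** b)) g = endo_eval (rep a) (endo_eval (rep b) g).
Proof. by have [[_ [_ ->]] _] := repE. Qed.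

Lemma rep_add a b g z : endo_eval (rep (a + b)) g z = endo_eval (rep a) g z + endo_eval (rep b) g z.
Proof. by have [[-> _] _] := repE. Qed.

Lemma rep_scale c a g z : endo_eval (rep (c *: a)) g z = c * endo_eval (rep a) g z.
Proof. by have [[_ [hZ _]] _] := repE; rewrite hZ wcomp_scaleE. Qed.

Definition prepends l (x : tail_seq V Ed) := foldr (prepend s) x l.

Lemma prependsP l w x : is_path l w -> maximal s r x -> (x 0%N).1 = w ->
  maximal s r (prepends l x) /\ (prepends l x 0%N).1 = src l w.
Proof.
move=> + mx xw; elim: l => //= e l IH /andP[/eqP re pl].
by have [mp p0] := IH pl; split=> //; apply: maximal_prepend; rewrite ?p0.
Qed.

Lemma rep_pY l w x g j : is_path l w -> maximal s r x -> (x 0%N).1 = w ->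
  endo_eval (rep (pY l w)) g (x, j) = g (prepends l x, j + (size l)%:Z).
Proof.
move=> + mx xw; elim: l g => [|e l IH] g /=.
  by have [_ [-> _]] := repE; rewrite wcompE /= xw eqxx asboolT // addr0.
move=> /andP[/eqP re pl]; rewrite rep_mul IH //.
have [mp p0] := prependsP pl mx xw.
have [_ [_ /(_ e)[_ ->]]] := repE; rewrite wcompE /= p0 re eqxx (asboolT mp) /=.
by rewrite -addrA -PoszD addn1.
Qed.

Lemma rep_pX l w x g j : is_path l w -> maximal s r x -> (x 0%N).1 = w ->
  endo_eval (rep (pX l w)) g (prepends l x, j + (size l)%:Z) = g (x, j).
Proof.
move=> + mx xw; elim: l g => [|e l IH] g /=.
  by have [_ [-> _]] := repE; rewrite wcompE /= xw eqxx asboolT // addr0.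
move=> pel; have /andP[/eqP re pl] := pel; rewrite rep_mul.
have [mp p0] := @prependsP (e :: l) w x pel mx xw.
have [_ [_ /(_ e)[-> _]]] := repE; rewrite wcompE /= (asboolT mp) eqxx /= prependK.
by rewrite (_ : j + (size l).+1%:Z - 1 = j + (size l)%:Z) ?IH //; lia.
Qed.

Definition mpath w := projT1 (cid (maximal_exists s r w)).

Lemma mpathP w : maximal s r (mpath w) /\ (mpath w 0%N).1 = w.
Proof. by rewrite /mpath; case: cid. Qed.

Lemma prepends_closed l w : term w -> closed_path l w -> prepends l (mpath w) = mpath w.
Proof.
move=> tw [pl lw]; have [mw w0] := mpathP w.
have [mp p0] := prependsP pl mw w0.
by apply: (term_maximal_uniq tw) => //; rewrite p0.
Qed.

(** Closed paths fix [mpath w], so only the level records the exponent. *)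
Lemma rep_cpow w k g j : term w ->
  endo_eval (rep (cpow w k)) g (mpath w, j) = g (mpath w, j - k * (period w)%:Z).
Proof.
move=> tw; have [mw w0] := mpathP w.
case: k => k; last first.
  have cl := rep_path_closed k.+1 tw.
  rewrite /cpow rep_pY ?cl.1 // prepends_closed // size_rep_path NegzE mulNr opprK.
  by rewrite PoszM.
have cl := rep_path_closed k tw.
rewrite /cpow -{1}(prepends_closed tw cl).
rewrite -{1}(subrK (size (rep_path k (cycle w)))%:Z j) rep_pX ?cl.1 //.
by rewrite size_rep_path PoszM.
Qed.

Definition delta z0 : M := fun z => if `[< z = z0 >] then 1 else 0.

(* The coefficient of the power of the cycle at [w] of degree [j] in an
   element of the corner at [w]. *)
Definition chi w b j : K := endo_eval (rep b) (delta (mpath w, 0)) (mpath w, j).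

Lemma chiD w a b j : chi w (a + b) j = chi w a j + chi w b j.
Proof. exact: rep_add. Qed.

Lemma chiZ w c a j : chi w (c *: a) j = c * chi w a j.
Proof. exact: rep_scale. Qed.

Lemma chi0 w j : chi w 0 j = 0.
Proof. by rewrite -[0](scale0r (0 : L)) chiZ mul0r. Qed.

Lemma chi_sum w (I : Type) (l : seq I) (F : I -> L) j :
  chi w (\sum_(i <- l) F i) j = \sum_(i <- l) chi w (F i) j.
Proof. by apply: (big_morph (fun a => chi w a j)) => [a b|]; rewrite ?chiD ?chi0. Qed.

Definition level w j := ((period w)%:Z %| j)%Z.
(** The power of the cycle of degree j, when [level w j] holds. At a sink the division by 0 returns
    0, which gives [P w]. *)
Definition upow w j := cpow w (j %/ (period w)%:Z)%Z.

Lemma cpow_upow w k : cpow w k = upow w (k * (period w)%:Z).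
Proof.
rewrite /upow; have [p0|p0] := posnP (period w); last by rewrite mulzK //; lia.
have c0 : cycle w = [::] by apply/size0nil.
have rep0 i : rep_path i (cycle w) = [::] by rewrite c0; elim: i.
by rewrite p0 mulr0; case: k => k; rewrite /cpow /= !rep0.
Qed.

Lemma level_mul w k : level w (k * (period w)%:Z).
Proof. exact: dvdz_mull. Qed.

Lemma chi_upow_mul w j b i : term w -> level w j ->
  chi w (upow w j ** b) i = chi w b (i - j).
Proof. by move=> tw wj; rewrite /chi rep_mul rep_cpow // divzK. Qed.

Lemma chi_upow w j i : term w -> level w j -> chi w (upow w j) i = (i == j)%:R.
Proof.
move=> tw wj; rewrite /chi rep_cpow // divzK // /delta.
case: asboolP => [[/eqP]|nij]; first by rewrite subr_eq0 => ->.
by case: eqP => // ij; case: nij; rewrite ij subrr.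
Qed.

Lemma corner_expand w b : term w -> P w ** b ** P w = b ->
  exists J, [/\ uniq J, forall j, j \in J -> level w j,
    forall j, chi w b j != 0 -> j \in J & b = \sum_(j <- J) chi w b j *: upow w j].
Proof.
move=> tw bw.
(* Quantifying over all larger lists allows the induction to add terms without tracking
   cancellations. *)
have [J JP JE] : exists2 J : seq int, (forall j, j \in J -> level w j) &
    forall J' : seq int, uniq J' -> {subset J <= J'} -> b = \sum_(j <- J') chi w b j *: upow w j.
  elim: (corner_lspan tw bw) => [|a _ x [k ->] _ [J JP JE]].
    by exists [::] => // J' _ _; rewrite big1 // => j _; rewrite chi0 scale0r.
  set j0 := k * (period w)%:Z; have lj0 : level w j0 by apply: level_mul.
  exists (j0 :: J) => [j|J' uJ' sJ]; first by rewrite inE => /orP[/eqP ->|/JP].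
  under eq_bigr do rewrite chiD chiZ cpow_upow chi_upow // scalerDl.
  rewrite big_split /= -JE //; last by move=> j jJ; apply: sJ; rewrite inE jJ orbT.
  congr (_ + _); rewrite (bigD1_seq j0) //=; last by apply: sJ; rewrite mem_head.
  rewrite eqxx mulr1 big1 ?addr0 ?cpow_upow // => j /negbTE ->.
  by rewrite mulr0 scale0r.
have bE := JE (undup J) (undup_uniq J) (fun j => etrans (mem_undup J j)).
exists (undup J); rewrite undup_uniq; split=> // j; first by rewrite mem_undup; apply: JP.
apply: contraR => jJ; rewrite bE chi_sum big1_seq // => i /andP[_ iJ].
rewrite chiZ chi_upow //; last by apply: JP; rewrite -mem_undup.
by case: eqP => [ji|]; rewrite ?mulr0 //; rewrite ji iJ in jJ.
Qed.

Lemma corner_eq0 w b : term w -> P w ** b ** P w = b -> (forall j, level w j -> chi w b j = 0) -> b = 0.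
Proof.
move=> tw /(corner_expand tw)[J [_ JP _ bE]] b0.
by rewrite bE big1_seq // => j /andP[_ /JP/b0 ->]; rewrite scale0r.
Qed.

Lemma sum_support (J J' : seq int) (F : int -> K) : uniq J -> uniq J' ->
  (forall j, F j != 0 -> j \in J) -> (forall j, F j != 0 -> j \in J') ->
  \sum_(j <- J) F j = \sum_(j <- J') F j.
Proof.
move=> uJ uJ' FJ FJ'; have red (l : seq int) : \sum_(j <- l) F j = \sum_(j <- [seq j <- l | F j != 0]) F j.
  rewrite big_filter [RHS]big_mkcond; apply: eq_bigr => j _.
  by case: eqP => [->|].
rewrite (red J) (red J'); apply/perm_big/uniq_perm; rewrite ?filter_uniq // => j.
by rewrite !mem_filter; case: (boolP (F j != 0)) => //= Fj; rewrite FJ ?FJ'.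
Qed.

Lemma chi_mul w b b' i (J : seq int) : term w -> P w ** b ** P w = b -> uniq J ->
  (forall j, chi w b j != 0 -> j \in J) ->
  chi w (b ** b') i = \sum_(j <- J) chi w b j * chi w b' (i - j).
Proof.
move=> tw bw uJ bJ; have [J' [uJ' J'P bJ' bE]] := corner_expand tw bw.
rewrite {1}bE namul_suml chi_sum.
have supp (l : seq int) : (forall j, chi w b j != 0 -> j \in l) ->
    forall j, chi w b j * chi w b' (i - j) != 0 -> j \in l.
  by move=> bl j; rewrite mulf_eq0 negb_or => /andP[/bl].
rewrite (sum_support (F := fun j => chi w b j * chi w b' (i - j)) uJ uJ'); try exact: supp.
by apply: eq_big_seq => j /J'P lj; rewrite namulZl chiZ chi_upow_mul.
Qed.

(** * Degrees of coefficients, and inverses in the corners *)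

Notation gr := (LP_grade P S Ss).

(** Compatibility with the level only for functions concentrated on one level; applied to [delta],
    it forces the coefficients of an element of degree m to vanish outside m. *)
Definition raises m x := forall i (g : M), (forall z, g z != 0 -> z.2 = i) ->
  forall z, endo_eval (rep x) g z != 0 -> z.2 = i + m.

Lemma raises_mul m k x y : raises m x -> raises k y -> raises (m + k) (x ** y).
Proof.
move=> rx ry i g gi z; rewrite rep_mul => nz.
by rewrite (rx _ _ (ry i g gi) z nz) -addrA [k + m]addrC.
Qed.

Lemma raises_gen c : raises (gen_deg c) (gen_val P S Ss c).
Proof.
move=> i g gi z; have [_ [rP rS]] := repE.
case: c => [v|e|e] /=; rewrite ?rP ?(rS e).1 ?(rS e).2 wcompE;
  (case: ifP; last by rewrite eqxx) => _ /gi /=.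
- by rewrite addr0.
- by move=> <-; rewrite subrK.
- by move=> <-; rewrite addrK.
Qed.

Lemma raises_word c ws : raises (word_deg c ws) (word_val P S Ss c ws).
Proof.
elim/last_ind: ws => [|ws h IH]; first by rewrite /word_deg big_nil addr0; apply: raises_gen.
rewrite /word_deg -cats1 big_cat big_seq1 /= addrA /word_val foldl_cat /=.
by apply: raises_mul IH _; apply: raises_gen.
Qed.

Lemma raises_grade m x : gr m x -> raises m x.
Proof.
move=> /gradeP; elim=> [|a _ y [c [ws [<- ->]]] _ IH] i g gi z.
  have [hr _] := repE; rewrite (nalg_hom0 hr).
  by rewrite (_ : endo_eval _ g z = 0) ?eqxx.
rewrite rep_add rep_scale => nz.
have [y0|] := eqVneq (endo_eval (rep y) g z) 0; last exact: IH.
move: nz; rewrite y0 addr0 mulf_eq0 negb_or => /andP[_].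
exact: raises_word.
Qed.

Lemma chi_grade m w b j : gr m b -> chi w b j != 0 -> j = m.
Proof.
move=> gb /(raises_grade gb (i := 0)) /= ->; first by rewrite add0r.
by move=> z; rewrite /delta; case: asboolP => [->|]; rewrite ?eqxx.
Qed.

(** A homogeneous corner element is a scalar multiple of a single power of the cycle. *)
Lemma corner_homog_inv m w b : term w -> P w ** b ** P w = b -> gr m b -> b <> 0 ->
  exists c, c ** b = P w /\ b ** c = P w.
Proof.
move=> tw bw gb b0; have [J [uJ JP bJ bE]] := corner_expand tw bw.
have bm : b = chi w b m *: upow w m.
  have [mJ|mJ] := boolP (m \in J).
    rewrite {1}bE (bigD1_seq m) //= big1 ?addr0 // => j jm.
    have [->|/(chi_grade gb) jE] := eqVneq (chi w b j) 0; first by rewrite scale0r.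
    by rewrite jE eqxx in jm.
  case: b0; rewrite bE big1_seq // => j /andP[_ jJ].
  have [->|/(chi_grade gb) jE] := eqVneq (chi w b j) 0; first by rewrite scale0r.
  by rewrite -jE jJ in mJ.
have c0 : chi w b m != 0 by apply/eqP => c0; apply: b0; rewrite bm c0 scale0r.
move: bm c0; rewrite /upow; move: (chi w b m) (m %/ _)%Z => lam k -> l0.
exists (lam^-1 *: cpow w (- k)); have [c1 c2] := cpow_unit k tw.
by split; rewrite namulZl namulZr scalerA ?c1 ?c2 ?mulVf ?mulfV // scale1r.
Qed.

(** Incomparability bounds the length of any list of such paths by [n], and a list of greatest
    length contains them all. *)
Lemma first_arrivals_exist w : exists l : seq (seq Ed), term w ->
  [/\ uniq l, forall p, (p \in l) = first_arrival (w, p) & (size l <= n)%N].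
Proof.
have [tw|] := pselect (term w); last by exists [::].
have bound l : uniq l -> all (fun p => first_arrival (w, p)) l -> (size l <= n)%N.
  move=> ul /allP fl; apply: (@paths_le w (size l) (nth [::] l)) => [i il|i j il jl ij].
    by have /fl/andP[] := mem_nth [::] il.
  apply: (@tpath_orth (w, nth [::] l i) (w, nth [::] l j)).
  - by split=> //; apply/fl/mem_nth.
  - by split=> //; apply/fl/mem_nth.
  - by case=> /eqP; rewrite nth_uniq // => /eqP.
pose Q k := `[< exists l, [/\ uniq l, all (fun p => first_arrival (w, p)) l & size l = k] >].
have exQ : exists k, Q k by exists 0%N; apply/asboolP; exists [::].
have ubQ k : Q k -> (k <= n)%N by move=> /asboolP[l [ul fl <-]]; apply: bound.
case: (ex_maxnP exQ ubQ) => k /asboolP[l [ul fl lk]] kmax.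
exists l => _; split=> //; last exact: bound.
move=> p; apply/idP/idP => [/(allP fl)//|fp]; apply/negPn/negP => pl.
suff : Q k.+1 by move/kmax; rewrite ltnn.
by apply/asboolP; exists (p :: l); rewrite /= pl ul fp fl lk.
Qed.

Definition arrivals w := projT1 (cid (first_arrivals_exist w)).

Lemma arrivalsP w : term w -> [/\ uniq (arrivals w),
  forall p, (p \in arrivals w) = first_arrival (w, p) & (size (arrivals w) <= n)%N].
Proof. by rewrite /arrivals; case: cid. Qed.

Lemma tpaths_arrivals w : term w -> tpaths [seq (w, p) | p <- arrivals w].
Proof.
move=> tw; have [ua aP _] := arrivalsP tw; split=> [|t /mapP[p pa ->]].
  by rewrite map_inj_uniq // => p q [].
by split=> //; rewrite -aP.
Qed.

(** A local unit of [a] may involve other terminal vertices, but these contribute zero; what is left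
    is absorbed by the unit of the block at [t.1]. *)
Lemma tY_mul_arrivals t a : tpath t ->
  tY t ** a = \sum_(p <- arrivals t.1) tY t ** a ** pX p t.1 ** pY p t.1.
Proof.
move=> tt; have tw := tt.1; have ta := tpaths_arrivals tw; have [_ aP _] := arrivalsP tw.
have -> : \sum_(p <- arrivals t.1) tY t ** a ** pX p t.1 ** pY p t.1 =
    tY t ** a ** eunit [seq (t.1, p) | p <- arrivals t.1].
  by rewrite /eunit big_map namul_sumr; apply: eq_bigr => p _; rewrite /= namulA.
have [l [ul tl] [_ al]] := local_unit a.
rewrite -al namulA {1 3}/eunit namul_sumr namul_suml; apply: eq_big_seq => u ul'.
have tu := tl u ul'; rewrite namulA.
have [e|e] := pselect (t.1 = u.1); last by rewrite cross0 // !namul0l.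
rewrite -[in RHS]namulA tY_eunit //; apply/mapP; exists u.2; last by rewrite e; case: (u).
by rewrite aP e; case: tu => _; case: (u).
Qed.

(** * The graded isomorphism *)

Definition arrival w k := nth [::] (arrivals w) k.

Lemma tpath_arrival w k : term w -> (k < size (arrivals w))%N -> tpath (w, arrival w k).
Proof.
by move=> tw kw; have [_ aP _] := arrivalsP tw; split=> //; rewrite -aP; apply: mem_nth.
Qed.

Lemma tpath_arrivalP t : tpath t -> exists i : 'I_(size (arrivals t.1)), t.2 = arrival t.1 i.
Proof.
move=> [tw ft]; have [_ aP _] := arrivalsP tw.
have ta : t.2 \in arrivals t.1 by rewrite aP; case: (t) ft.
have it : (index t.2 (arrivals t.1) < size (arrivals t.1))%N by rewrite index_mem.
by exists (Ordinal it); rewrite /arrival nth_index.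
Qed.

Lemma arrival_inj w (i j : 'I_(size (arrivals w))) : term w ->
  arrival w i = arrival w j -> i = j.
Proof.
move=> tw; have [ua _ _] := arrivalsP tw; move/eqP; rewrite nth_uniq // => /eqP.
exact: val_inj.
Qed.

Definition entry w p q a := chi w (pY p w ** a ** pX q w).

Lemma corner_entry w p q a :
  P w ** (pY p w ** a ** pX q w) ** P w = pY p w ** a ** pX q w.
Proof. by rewrite -namulA -[_ ** P w]namulA (pX_end HL) !namulA (end_pY HL). Qed.

Lemma entryD w p q a b j : entry w p q (a + b) j = entry w p q a j + entry w p q b j.
Proof. by rewrite /entry namulDr namulDl chiD. Qed.

Lemma entryZ w p q c a j : entry w p q (c *: a) j = c * entry w p q a j.
Proof. by rewrite /entry namulZr namulZl chiZ. Qed.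

Lemma entry_sum w p q (I : Type) (l : seq I) (F : I -> L) j :
  entry w p q (\sum_(i <- l) F i) j = \sum_(i <- l) entry w p q (F i) j.
Proof. by rewrite /entry namul_sumr namul_suml chi_sum. Qed.

Lemma entry_level w p q a j : term w -> entry w p q a j != 0 -> level w j.
Proof.
move=> tw; have [J [_ JP bJ _]] := corner_expand tw (corner_entry w p q a).
by move/bJ/JP.
Qed.

(** Matrix multiplication with convolution of coefficients; [J] has to contain the supports of all
    entries in row [p]. *)
Lemma entry_mul w p q a b i (J : seq int) : tpath (w, p) -> uniq J ->
  (forall u j, u \in arrivals w -> entry w p u a j != 0 -> j \in J) ->
  entry w p q (a ** b) i =
  \sum_(u <- arrivals w) \sum_(j <- J) entry w p u a j * entry w u q b (i - j).
Proof.
move=> tp uJ aJ; have tw : term w := tp.1.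
rewrite {1}/entry namulA (tY_mul_arrivals a tp) /= !namul_suml chi_sum.
apply: eq_big_seq => u ua.
rewrite (_ : _ ** pX q w = pY p w ** a ** pX u w ** (pY u w ** b ** pX q w)); last first.
  by rewrite !namulA.
by rewrite (chi_mul _ _ tw (corner_entry w p u a) uJ) // => j; apply: aJ.
Qed.

Lemma grade_entry m w p q a j : gr m a -> entry w p q a j != 0 ->
  j + (size p)%:Z - (size q)%:Z = m.
Proof.
move=> ga; have gb := gradeM (gradeM (grade_pY P S Ss p w) ga) (grade_pX P S Ss q w).
by move/(chi_grade gb) => ->; lia.
Qed.

Lemma unit_expand a : exists2 l, tpaths l &
  a = \sum_(t <- l) \sum_(u <- l) tX t ** (tY t ** a ** tX u) ** tY u.
Proof.
have [l tl [la al]] := local_unit a; exists l => //.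
rewrite -{1}la {1}/eunit namul_suml; apply: eq_bigr => t _.
rewrite -{1}al {1}/eunit !namul_sumr; apply: eq_bigr => u _.
by rewrite !namulA.
Qed.

Lemma entry_eq0 a :
  (forall w (p q : 'I_(size (arrivals w))) j, term w -> level w j ->
     entry w (arrival w p) (arrival w q) a j = 0) -> a = 0.
Proof.
move=> a0; have [l [_ tl] ->] := unit_expand a.
rewrite big1_seq // => t /andP[_ /tl tt]; rewrite big1_seq // => u /andP[_ /tl tu].
suff -> : tY t ** a ** tX u = 0 by rewrite namul0r namul0l.
have [e|] := pselect (t.1 = u.1); last exact: cross0.
have [i iE] := tpath_arrivalP tt; have [k kE] := tpath_arrivalP tu.
move: k kE; rewrite -e => k kE; rewrite iE kE.
apply: (corner_eq0 tt.1); first exact: corner_entry.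
by move=> j; apply: a0; case: tt.
Qed.

Lemma grade_upow w j : level w j -> gr j (upow w j).
Proof.
move=> /divzK {1}<-; rewrite /upow; case: (_ %/ _)%Z => k.
  by have := grade_pX P S Ss (rep_path k (cycle w)) w; rewrite size_rep_path PoszM.
have := grade_pY P S Ss (rep_path k.+1 (cycle w)) w.
by rewrite size_rep_path PoszM NegzE mulNr.
Qed.

Lemma grade_of_entries m a :
  (forall w (p q : 'I_(size (arrivals w))) j, term w -> level w j ->
     entry w (arrival w p) (arrival w q) a j != 0 ->
     j + (size (arrival w p))%:Z - (size (arrival w q))%:Z = m) -> gr m a.
Proof.
move=> am; have [l [_ tl] ->] := unit_expand a.
apply: grade_sum => t /tl tt; apply: grade_sum => u /tl tu.
have [e|e] := pselect (t.1 = u.1); last first.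
  by rewrite cross0 // namul0r namul0l; apply: grade0.
have [i iE] := tpath_arrivalP tt; have [k kE] := tpath_arrivalP tu.
move: k kE; rewrite -e => k kE; rewrite iE kE.
have [J [_ JP bJ ->]] := corner_expand tt.1 (corner_entry t.1 (arrival t.1 i) (arrival t.1 k) a).
rewrite namul_sumr namul_suml; apply: grade_sum => j /JP lj; rewrite namulZr namulZl.
have [->|nz] := eqVneq (chi t.1 (pY (arrival t.1 i) t.1 ** a ** pX (arrival t.1 k) t.1) j) 0.
  by rewrite scale0r; apply: grade0.
apply: gradeZ; rewrite -(am _ _ _ _ tt.1 lj nz) [j + _]addrC.
by apply: gradeM; [apply: gradeM; [exact: grade_pX|exact: grade_upow]|exact: grade_pY].
Qed.

Lemma cpow_corner w k : term w -> P w ** cpow w k = cpow w k /\ cpow w k ** P w = cpow w k.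
Proof.
move=> tw; case: k => k; rewrite /cpow.
  have [_ sk] := rep_path_closed k tw; split; last exact: (pX_end HL).
  by have := src_pX HL (rep_path k (cycle w)) w; rewrite sk.
have [_ sk] := rep_path_closed k.+1 tw; split; first exact: (end_pY HL).
by have := pY_src HL (rep_path k.+1 (cycle w)) w; rewrite sk.
Qed.

Definition munit w p q j := pX p w ** upow w j ** pY q w.

Lemma entry_munit w p q j w' p' q' j' : tpath (w, p) -> tpath (w, q) ->
  tpath (w', p') -> tpath (w', q') -> level w j ->
  entry w' p' q' (munit w p q j) j' = [&& w' == w, p' == p, q' == q & j' == j]%:R.
Proof.
move=> tp tq tp' tq' lj; rewrite /entry /munit !namulA.
have orth t u : tpath t -> tpath u -> tY t ** tX u = if t == u then P t.1 else 0.
  by move=> tt tu; case: eqP => [<-|]; [apply: tpath_id|apply: tpath_orth].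
rewrite (orth _ _ tp' tp) -namulA (orth _ _ tq tq') /= !xpair_eqE [w == _]eq_sym [q == _]eq_sym.
case: (w' =P w) => [->|] /=; last by rewrite !namul0l chi0.
case: eqP => _ /=; last by rewrite !namul0l chi0.
case: eqP => _ /=; last by rewrite namul0r chi0.
rewrite -(chi_upow j' tp.1 lj); congr chi.
by have [-> ->] := cpow_corner (j %/ (period w)%:Z)%Z tp.1.
Qed.

(** The [classic] alias provides the equality test used for finite sums over these index types. *)
Definition sinks := {classic {w : V | sink w}}.
Definition bases := {classic {w : V | base w}}.
Definition nsink (i : sinks) := size (arrivals (sval i)).
Definition nbase (j : bases) := size (arrivals (sval j)).

(** At a sink only degree 0 occurs. At a base point x stands for the cycle, hence exponent k is read
    at degree k times the period. *)
Definition phi (a : L) : dsum K nsink nbase :=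
  ((fun i => \matrix_(p, q) entry (sval i) (arrival (sval i) p) (arrival (sval i) q) a 0),
   (fun j => \matrix_(p, q) fun k : int =>
      entry (sval j) (arrival (sval j) p) (arrival (sval j) q) a (k * (period (sval j))%:Z))).

Lemma sink_term (i : sinks) : term (sval i).
Proof. by left; apply: svalP i. Qed.

Lemma base_term (j : bases) : term (sval j).
Proof. by right; apply: svalP j. Qed.

Lemma level_sink (i : sinks) k : level (sval i) k -> k = 0.
Proof. by rewrite /level period_sink ?dvd0z; [move/eqP|apply: svalP i]. Qed.

Lemma level_base (j : bases) k : level (sval j) k -> exists k', k = k' * (period (sval j))%:Z.
Proof. by move/dvdzP. Qed.

Lemma period_base (j : bases) : (0 < period (sval j))%N.
Proof. by apply: period_gt0; apply: svalP j. Qed.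

Lemma phi_add x y : ds_add_rel (phi x) (phi y) (phi (x + y)).
Proof.
split=> [i|j p q k]; first by apply/matrixP => p q; rewrite !mxE entryD.
by rewrite !mxE entryD.
Qed.

Lemma phi_scale a x : ds_scale_rel a (phi x) (phi (a *: x)).
Proof.
split=> [i|j p q k]; first by apply/matrixP => p q; rewrite !mxE entryZ.
by rewrite !mxE entryZ.
Qed.

Lemma phi_mul x y : ds_mul_rel (phi x) (phi y) (phi (x ** y)).
Proof.
split=> [i|j p q k N xN].
  apply/matrixP => p q; rewrite !mxE.
  rewrite (@entry_mul _ _ _ _ _ _ [:: 0]) //; last first.
  - by move=> u j _ /(entry_level (sink_term i))/level_sink ->; rewrite inE.
  - exact: (tpath_arrival (sink_term i) (ltn_ord p)).
  rewrite (big_nth [::]) big_mkord; apply: eq_bigr => u _.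
  by rewrite big_seq1 subr0 !mxE.
have tj := base_term j; have [ua _ _] := arrivalsP tj.
set t := (period (sval j))%:Z; have t0 : t != 0 by rewrite /t; have := period_base j; lia.
(* The list of degrees is the window of [lmulN] scaled by the period, which is nonzero, so its
   members are distinct. *)
rewrite mxE (@entry_mul _ _ _ _ _ _ [seq (i%:Z - N%:Z) * t | i <- iota 0 (2 * N).+1]); first last.
- move=> u l ua' nz; have [l' lE] := level_base (entry_level tj nz).
  apply/mapP; have lN : (absz l' <= N)%N.
    rewrite leqNgt; apply/negP => Nl; have iu : (index u (arrivals (sval j)) < nbase j)%N by rewrite index_mem.
    have := xN (Ordinal iu) l' Nl; rewrite mxE /arrival nth_index // -lE => z.
    by rewrite z eqxx in nz.
  exists (absz (l' + N%:Z)); first by rewrite mem_iota; lia.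
  by rewrite lE; congr (_ * _); lia.
- rewrite map_inj_uniq ?iota_uniq // => a b /(mulIf t0) /addIr.
  by case.
- exact: (tpath_arrival tj (ltn_ord p)).
rewrite (big_nth [::]) big_mkord; apply: eq_bigr => u _.
rewrite big_map /lmulN -(big_mkord xpredT (fun i => _ u (i%:Z - N%:Z) * _ (k - (i%:Z - N%:Z)))).
by apply: eq_bigr => i _; rewrite !mxE -mulrBl.
Qed.

Lemma sig_list (Q : V -> Prop) (l : seq V) :
  exists li : seq {classic {w | Q w}},
    forall i : {classic {w | Q w}}, sval i \in l -> i \in li.
Proof.
elim: l => [|w l [li IH]]; first by exists [::].
have [Qw|nQ] := pselect (Q w).
  pose w' : {classic {w | Q w}} := exist Q w Qw.
  exists (w' :: li) => i; rewrite inE => /orP[/eqP iw|/IH il]; rewrite inE ?il ?orbT //.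
  by rewrite (_ : i = w') ?eqxx //; case: (i) iw => u Qu /= uw; apply: eq_exist.
exists li => i; rewrite inE => /orP[/eqP iw|/IH//].
by case: nQ; rewrite -iw; apply: svalP i.
Qed.

(** Only the finitely many terminal vertices occurring in a local unit of [x] give nonzero
    blocks. *)
Lemma phi_fin x : ds_fin (phi x).
Proof.
have [l [_ tl] [_ xl]] := local_unit x.
have x0 w q : w \notin [seq t.1 | t <- l] -> tpath (w, q) -> x ** pX q w = 0.
  move=> wl tq; rewrite -xl /eunit namul_sumr namul_suml big1_seq // => t /andP[_ tl'].
  rewrite -!namulA (@tpath_orth t (w, q) (tl _ tl') tq) ?namul0r // => e.
  by move/negP: wl; apply; apply/mapP; exists t; rewrite // e.
split; [|split].
- have [li liP] := sig_list sink [seq t.1 | t <- l].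
  exists li => i nli; apply/matrixP => p q; rewrite !mxE /entry -namulA x0 ?namul0r ?chi0 //.
    by apply/negP => /liP/InP.
  exact: (tpath_arrival (sink_term i) (ltn_ord q)).
- have [lj ljP] := sig_list base [seq t.1 | t <- l].
  exists lj => j nlj p q k; rewrite !mxE /entry -namulA x0 ?namul0r ?chi0 //.
    by apply/negP => /ljP/InP.
  exact: (tpath_arrival (base_term j) (ltn_ord q)).
move=> j p q; set b := pY (arrival (sval j) p) (sval j) ** x ** pX (arrival (sval j) q) (sval j).
have [J [_ _ bJ _]] := corner_expand (base_term j) (corner_entry _ _ _ _ : _ = b).
exists (\max_(i <- J) absz i) => k kJ; rewrite mxE; apply/eqP/negPn/negP => /bJ kJ'.
have := leq_bigmax_seq (P := xpredT) (F := absz) _ kJ' isT.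
rewrite abszM => /(leq_trans (leq_pmulr _ (period_base j))).
by rewrite leqNgt kJ.
Qed.

Lemma phi_inj x y : ds_eq (phi x) (phi y) -> x = y.
Proof.
move=> [xy1 xy2]; apply/eqP; rewrite -subr_eq0; apply/eqP/entry_eq0 => w p q j tw lj.
rewrite -scaleN1r entryD entryZ mulN1r; apply/eqP; rewrite subr_eq0; apply/eqP.
case: tw => [sw|bw].
  have := xy1 (exist _ w sw); move/matrixP/(_ p q); rewrite !mxE.
  by rewrite (level_sink (i := exist _ w sw) lj).
have [k ->] := level_base (j := exist _ w bw) lj.
by have := xy2 (exist _ w bw) p q k; rewrite !mxE.
Qed.

Lemma phi_surj d : ds_fin d -> exists x, ds_eq (phi x) d.
Proof.
move=> [[li liP] [[lj ljP] dN]].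
have /choice[N NP] : forall j : bases, exists N : nat, forall p q k,
    (N < absz k)%N -> d.2 j p q k = 0.
  move=> j; have /choice[bf bfP] : forall pq, exists b : nat,
      forall k, (b < absz k)%N -> d.2 j pq.1 pq.2 k = 0 by move=> pq; apply: dN.
  exists (\max_pq bf pq) => p q k kb; apply: (bfP (p, q)); apply: leq_ltn_trans kb.
  exact: (leq_bigmax (p, q)).
(* The preimage is the corresponding combination of matrix units, block by block. *)
pose a1 (i : sinks) := \sum_(p < nsink i) \sum_(q < nsink i)
  d.1 i p q *: munit (sval i) (arrival (sval i) p) (arrival (sval i) q) 0.
pose a2 (j : bases) := \sum_(p < nbase j) \sum_(q < nbase j) \sum_(k < (2 * N j).+1)
  d.2 j p q (k%:Z - (N j)%:Z) *:
    munit (sval j) (arrival (sval j) p) (arrival (sval j) q)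
          ((k%:Z - (N j)%:Z) * (period (sval j))%:Z).
have lv0 w : level w 0 by apply: dvdz0.
have ti (i : sinks) (p : 'I_(nsink i)) := tpath_arrival (sink_term i) (ltn_ord p).
have tj (j : bases) (p : 'I_(nbase j)) := tpath_arrival (base_term j) (ltn_ord p).
have a1_other (i : sinks) w p q k : w <> sval i -> tpath (w, p) -> tpath (w, q) -> entry w p q (a1 i) k = 0.
  move=> /eqP wi tp tq; rewrite entry_sum big1 // => p' _; rewrite entry_sum big1 // => q' _.
  by rewrite entryZ entry_munit ?(negbTE wi) ?mulr0 //; apply: ti.
have a2_other (j : bases) w p q k : w <> sval j -> tpath (w, p) -> tpath (w, q) -> entry w p q (a2 j) k = 0.
  move=> /eqP wj tp tq; rewrite entry_sum big1 // => p' _; rewrite entry_sum big1 // => q' _.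
  rewrite entry_sum big1 // => k' _.
  by rewrite entryZ entry_munit ?(negbTE wj) ?mulr0 //; (apply: tj || apply: level_mul).
have a1_same (i : sinks) (p q : 'I_(nsink i)) : entry (sval i) (arrival (sval i) p) (arrival (sval i) q) (a1 i) 0 = d.1 i p q.
  rewrite entry_sum (bigD1 p) //= [X in _ + X]big1 ?addr0 => [|p' pp'].
    rewrite entry_sum (bigD1 q) //= [X in _ + X]big1 ?addr0 => [|q' qq'].
      by rewrite entryZ entry_munit ?eqxx ?mulr1 //; apply: ti.
    rewrite entryZ entry_munit //; try exact: ti.
    case: (arrival _ q =P _) => [/(arrival_inj (sink_term i)) e|]; rewrite ?andbF ?mulr0 //.
    by rewrite e eqxx in qq'.
  rewrite entry_sum big1 // => q' _; rewrite entryZ entry_munit //; try exact: ti.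
  case: (arrival _ p =P _) => [/(arrival_inj (sink_term i)) e|]; rewrite ?andbF ?mulr0 //.
  by rewrite e eqxx in pp'.
have a2_same (j : bases) (p q : 'I_(nbase j)) (k : int) : entry (sval j) (arrival (sval j) p) (arrival (sval j) q) (a2 j)
    (k * (period (sval j))%:Z) = d.2 j p q k.
  have t0 : (period (sval j))%:Z != 0 by have := period_base j; lia.
  rewrite entry_sum (bigD1 p) //= [X in _ + X]big1 ?addr0 => [|p' pp'].
    rewrite entry_sum (bigD1 q) //= [X in _ + X]big1 ?addr0 => [|q' qq'].
      rewrite entry_sum.
      under eq_bigr => k' _.
        rewrite entryZ entry_munit; [|exact: tj|exact: tj|exact: tj|exact: tj|exact: level_mul].
        rewrite !eqxx /= (inj_eq (mulIf t0)).
        over.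
      (* Exponent k sits at index k + N; outside [-N, N] both sides vanish. *)
      have [kN|kN] := leqP (absz k) (N j).
        have kb : (absz (k + (N j)%:Z)%R < (2 * N j).+1)%N by lia.
        rewrite (bigD1 (Ordinal kb)) //= big1 ?addr0.
          have -> : (absz (k + (N j)%:Z)%R)%:Z - (N j)%:Z = k by lia.
          by rewrite eqxx mulr1.
        move=> k' /eqP kk'; case: eqP => [e|]; rewrite ?mulr0 //.
        by case: kk'; apply: val_inj => /=; lia.
      rewrite NP // big1 // => k' _; case: eqP => [e|]; rewrite ?mulr0 //.
      by rewrite -e NP // mul0r.
    rewrite entry_sum big1 // => k' _.
    rewrite entryZ entry_munit; [|exact: tj|exact: tj|exact: tj|exact: tj|exact: level_mul].
    case: (arrival _ q =P _) => [/(arrival_inj (base_term j)) e|]; rewrite ?andbF ?mulr0 //.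
    by rewrite e eqxx in qq'.
  rewrite entry_sum big1 // => q' _; rewrite entry_sum big1 // => k' _.
  rewrite entryZ entry_munit; [|exact: tj|exact: tj|exact: tj|exact: tj|exact: level_mul].
  case: (arrival _ p =P _) => [/(arrival_inj (base_term j)) e|]; rewrite ?andbF ?mulr0 //.
  by rewrite e eqxx in pp'.
have sink_base (i : sinks) (j : bases) : sval i <> sval j.
  by move=> ij; apply: (cyc_nsink (svalP j).1); rewrite -ij; apply: svalP i.
have sval_neq (Q : V -> Prop) (i i' : {classic {w | Q w}}) : i != i' -> sval i <> sval i'.
  by move/eqP => ii' e; apply: ii'; case: i i' e => u Qu [u' Qu'] /= e; apply: eq_exist.
exists (\sum_(i <- undup li) a1 i + \sum_(j <- undup lj) a2 j); split=> [i|j p q k].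
  apply/matrixP => p q; rewrite mxE entryD !entry_sum [X in _ + X]big1 ?addr0; last first.
    by move=> j _; apply: a2_other => //; apply: ti.
  have [ili|ili] := boolP (i \in li).
    rewrite (bigD1_seq i) ?undup_uniq ?mem_undup //= big1 ?addr0 ?a1_same // => i' ii'.
    apply: a1_other; [|exact: ti|exact: ti].
    by apply: sval_neq; rewrite eq_sym.
  rewrite (liP i); last by move/InP; apply/negP.
  rewrite mxE big1_seq // => i' /andP[_]; rewrite mem_undup => i'li.
  apply: a1_other; [|exact: ti|exact: ti].
  by apply: sval_neq; apply: contraNneq ili => ->.
rewrite mxE entryD !entry_sum [X in X + _]big1 ?add0r; last first.
  by move=> i _; apply: a1_other; [move/esym; apply: sink_base|exact: tj|exact: tj].
have [jlj|jlj] := boolP (j \in lj).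
  rewrite (bigD1_seq j) ?undup_uniq ?mem_undup //= big1 ?addr0 ?a2_same // => j' jj'.
  apply: a2_other; [|exact: tj|exact: tj].
  by apply: sval_neq; rewrite eq_sym.
rewrite (ljP j); last by move/InP; apply/negP.
rewrite big1_seq // => j' /andP[_]; rewrite mem_undup => j'lj.
apply: a2_other; [|exact: tj|exact: tj].
by apply: sval_neq; apply: contraNneq jlj => ->.
Qed.

Lemma nil_index_decomp : gr_decomp_le gr n.
Proof.
exists sinks, bases, nsink, nbase, (fun i p => (size (arrival (sval i) p))%:Z),
  (fun j => period (sval j)), (fun j p => (size (arrival (sval j) p))%:Z), phi.
split; first by move=> i; have [] := arrivalsP (sink_term i).
split; first by move=> j; have [] := arrivalsP (base_term j).
split; first exact: period_base.
split.
  split; first exact: phi_add.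
  split; first exact: phi_scale.
  split; first exact: phi_mul.
  split; first exact: phi_fin.
  by split; [exact: phi_inj|exact: phi_surj].
move=> m x; split=> [gx|[hx1 hx2]].
  split=> [i p q|j p q k]; rewrite mxE => /eqP nz.
    by rewrite -(grade_entry gx nz) add0r.
  exact: (grade_entry gx nz).
apply: grade_of_entries => w p q j tw lj /eqP; case: tw => [sw|bw].
  rewrite (level_sink (i := exist _ w sw) lj) add0r => nz.
  by apply: (hx1 (exist _ w sw) p q); rewrite mxE.
have [k ->] := level_base (j := exist _ w bw) lj => nz.
by apply: (hx2 (exist _ w bw) p q k); rewrite mxE.
Qed.

(** * Graded semisimplicity in the case of bounded index *)

Lemma homog_sum a : exists k (c : 'I_k -> L) (dg : 'I_k -> int),
  (forall i, gr (dg i) (c i)) /\ a = \sum_(i < k) c i.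
Proof.
elim: (lspan_homog HL a) => [|b g x [m gm] _ [k [c [dg [cP ->]]]]].
  exists 0%N, (fun=> 0), (fun=> 0); split; [by case|by rewrite big_ord0].
exists k.+1, (fun i => if unlift ord0 i is Some j then c j else b *: g),
  (fun i => if unlift ord0 i is Some j then dg j else m).
split=> [i|]; first by case: unliftP => [j|] _ //; apply: gradeZ.
rewrite big_ord_recl unlift_none; congr (_ + _).
by apply: eq_bigr => i _; rewrite liftK.
Qed.

Lemma tpath_seq l : tpaths l -> exists l' : seq {t | tpath t}, l = [seq sval t | t <- l'].
Proof.
move=> [_]; elim: l => [|t l IH] tl; first by exists [::].
have [l' ->] : exists l' : seq {t | tpath t}, l = [seq sval t | t <- l'].
  by apply: IH => u ul; apply: tl; rewrite inE ul orbT.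
by exists (exist _ t (tl t (mem_head t l)) :: l').
Qed.

Lemma grade_tXY m a t : gr m a -> gr m (a ** (tX t ** tY t)) /\ gr m (tX t ** tY t ** a).
Proof.
move=> ga; have gxy := gradeM (grade_pX P S Ss t.2 t.1) (grade_pY P S Ss t.2 t.1).
rewrite subrr in gxy.
by split; [have := gradeM ga gxy|have := gradeM gxy ga]; rewrite ?addr0 ?add0r.
Qed.

Lemma homog_entry_inv m a t u : tpath t -> tpath u -> gr m a -> tY t ** a ** tX u <> 0 ->
  exists g, g ** (tY t ** a ** tX u) = tY u ** tX u /\ (tY t ** a ** tX u) ** g = tY t ** tX t.
Proof.
move=> tt tu ga nz.
have [e|/(cross0 a tt tu)//] := pselect (t.1 = u.1).
have gb := gradeM (gradeM (grade_pY P S Ss t.2 t.1) ga) (grade_pX P S Ss u.2 u.1).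
rewrite !tpath_id //; move: nz gb; rewrite -e => nz gb.
exact: corner_homog_inv tt.1 (corner_entry _ _ _ _) gb nz.
Qed.

Lemma tX_neq0 t : tpath t -> tX t <> 0.
Proof. by move=> tt t0; apply: (@vert_neq0 t.1); rewrite -tpath_id // t0 namul0r. Qed.

Lemma tY_neq0 t : tpath t -> tY t <> 0.
Proof. by move=> tt t0; apply: (@vert_neq0 t.1); rewrite -tpath_id // t0 namul0l. Qed.

Lemma nil_index_semisimple : gr_semisimple gr true /\ gr_semisimple gr false.
Proof.
pose T := {t : V * seq Ed | tpath t}.
have tY_tX (t : T) : tY (sval t) ** tX (sval t) = P (sval t).1 by apply/tpath_id/svalP.
have orth (t u : T) : t <> u -> tY (sval t) ** tX (sval u) = 0.
  move=> tu; apply: tpath_orth; [exact: svalP|exact: svalP|].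
  by case: t u tu => t Ht [u Hu] /= tu e; apply: tu; apply: eq_exist.
have xyx (t : T) : tX (sval t) ** tY (sval t) ** tX (sval t) = tX (sval t).
  by rewrite -namulA tY_tX (pX_end HL).
have yxy (t : T) : tY (sval t) ** tX (sval t) ** tY (sval t) = tY (sval t).
  by rewrite tY_tX (end_pY HL).
have unit a : exists l : seq T, a = \sum_(t <- l) tX (sval t) ** tY (sval t) ** a /\
    a = \sum_(t <- l) a ** (tX (sval t) ** tY (sval t)).
  have [l /tpath_seq[l' ->] [la al]] := local_unit a; exists l'.
  by rewrite -{1}la -{3}al /eunit big_map namul_suml namul_sumr.
split.
  apply: (@gr_semisimple_family K L gr T (fun t => tX (sval t)) (fun t => tY (sval t))) => //.
  - by move=> t; apply/tX_neq0/svalP.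
  - by move=> a; have [l []] := unit a; exists l.
  - by move=> a; have [l []] := unit a; exists l.
  - exact: homog_sum.
  - by move=> m a t ga; case: (grade_tXY (sval t) ga).
  - move=> m a t u ga nz.
    by have [g []] := homog_entry_inv (svalP t) (svalP u) ga nz; exists g.
(* Right ideals of [L] are left ideals of [op_nalg L], where paths and ghost paths exchange their
   parts. *)
apply: (@gr_semisimple_family K (op_nalg L) gr T (fun t => tY (sval t)) (fun t => tX (sval t))).
- by move=> t u tu; apply: (orth u t) => /esym.
- by move=> t /=; rewrite namulA yxy.
- by move=> t /=; rewrite namulA xyx.
- by move=> t; apply/tY_neq0/svalP.
- by move=> a; have [l [_ E]] := unit a; exists l.
- by move=> a; have [l [E _]] := unit a; exists l.
- exact: homog_sum.
- by move=> m a t ga; case: (grade_tXY (sval t) ga).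
move=> m a t u ga; rewrite /= namulA => nz.
have [g [_ E]] := homog_entry_inv (svalP u) (svalP t) ga nz.
by exists g.
Qed.
End BoundedIndex.

Local Close Scope ring_scope.

Theorem theorem2p4 (K : fieldType) (V Ed : Type) (s r : Ed -> V)
  (Hrf : row_finite s) (L : nalg K) (P : V -> L) (S Ss : Ed -> L)
  (HL : is_LPA s r P S Ss) (n : nat) (hn : (0 < n)%N) :
  (nil_index_le L n <-> gr_decomp_le (LP_grade P S Ss) n) /\
  (nil_index_le L n ->
     gr_semisimple (LP_grade P S Ss) true /\ gr_semisimple (LP_grade P S Ss) false).
Proof.
split; [split=> [nilL|]|move=> nilL].
(* [{classic V}] is [V] itself with a classical equality test, so the result for types with equality
   applies to arbitrary graphs. *)
- exact: (@nil_index_decomp K {classic V} {classic Ed} s r Hrf L P S Ss HL n hn nilL).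
- exact: decomp_nil_index hn.
- exact: (@nil_index_semisimple K {classic V} {classic Ed} s r Hrf L P S Ss HL n hn nilL).
Qed.
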